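(* Let $\mu\in(0,1]$, let $p_1<p_2$ be finite real numbers, and let $u_0$ be a tempered distribution on $\mathbb{R}$ satisfying Condition (C1$_{[p_1,p_2],\mu}$) (see context). Let $u_S:\mathbb{R}_+\times\mathbb{R}\to\mathbb{C}$ be the solution of the free Schrödinger equation $[i\partial_t+\partial_{xx}]u_S(t)=0$ for $t\geqslant0$, with $u_S(0)=u_0$. Then there is a constant $c(u_0,f_S)>0$ such that $$\forall\,t\geqslant1\qquad \|u_S(t,\cdot)\|_{L^\infty(\mathbb{R})}\leqslant c(u_0,f_S)\,t^{-\frac\mu2},$$ and the decay rate is optimal: there are no $\gamma>\frac\mu2$ and $C>0$ such that $\|u_S(t,\cdot)\|_{L^\infty(\mathbb{R})}\leqslant C\,t^{-\gamma}$ for all $t\geqslant1$.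
   Context: Fourier transform: $\mathcal{F}u(p)=\int_{\mathbb{R}}u(x)e^{-ixp}\,dx$, extended to tempered distributions. With $f_S(p)=p^2$, the solution is $$u_S(t,x)=\frac{1}{2\pi}\int_{\mathbb{R}}\mathcal{F}u_0(p)\,e^{-itp^2+ixp}\,dp.$$ Condition (C1$_{[p_1,p_2],\mu}$): $\mathcal{F}u_0$ is a complex-valued function with $\mathrm{supp}\,\mathcal{F}u_0\subseteq[p_1,p_2]$ and $\mathcal{F}u_0(p)=(p-p_1)^{\mu-1}\,\tilde u(p)$ for all $p\in(p_1,p_2]$, where $\tilde u\in\mathcal{C}^1([p_1,p_2],\mathbb{C})$ and $\tilde u(p_1)\neq0$. *)

(* Defs.v *)
From HB Require Import structures.
From mathcomp Require Import all_boot all_order all_algebra.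
From mathcomp Require Import complex.
From mathcomp Require Import all_classical all_reals all_analysis.

Set Implicit Arguments.
Unset Strict Implicit.
Unset Printing Implicit Defensive.

Import Order.TTheory GRing.Theory Num.Theory.
Import numFieldNormedType.Exports.

Local Open Scope classical_set_scope.
Local Open Scope ring_scope.
Local Open Scope complex_scope.

Section complex_valued_functions.
Context {R : realType}.

Definition cmod (z : R[i]) : R := Normc.normc z.

Definition cis (theta : R) : R[i] := cos theta +i* sin theta.

Definition cintegrable (f : R -> R[i]) : Prop :=
  (@lebesgue_measure R).-integrable setT (fun x => (complex.Re (f x))%:E) /\
  (@lebesgue_measure R).-integrable setT (fun x => (complex.Im (f x))%:E).

(* Total, but meaningful only when [cintegrable f]. This holds for the
   integrands of [fourier] at a Schwartz function and of [solution] under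
   [condition_C1]. *)
Definition cintegral (f : R -> R[i]) : R[i] :=
  Rintegral lebesgue_measure setT (fun x => complex.Re (f x)) +i*
  Rintegral lebesgue_measure setT (fun x => complex.Im (f x)).

Definition cderive1n (n : nat) (f : R -> R[i]) (x : R) : R[i] :=
  derive1n n (fun y => complex.Re (f y)) x +i*
  derive1n n (fun y => complex.Im (f y)) x.

Definition smooth (f : R -> R) : Prop :=
  forall (n : nat) (x : R), derivable (derive1n n f) x 1.

Definition csmooth (f : R -> R[i]) : Prop :=
  smooth (fun x => complex.Re (f x)) /\ smooth (fun x => complex.Im (f x)).

Definition clocally_integrable (f : R -> R[i]) : Prop :=
  locally_integrable setT (fun x => complex.Re (f x)) /\
  locally_integrable setT (fun x => complex.Im (f x)).

(* C^1 on the closed interval [a, b], with one-sided derivatives at the end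
   points; the values of [f] outside [a, b] are irrelevant. *)
Definition C1_itv (a b : R) (f : R -> R) : Prop :=
  exists2 f' : R -> R, {within `[a, b], continuous f'} &
    forall x, x \in `[a, b] ->
      (f y - f x) / (y - x) @[y --> within `[a, b] (dnbhs x)] --> f' x.

Definition cC1_itv (a b : R) (f : R -> R[i]) : Prop :=
  C1_itv a b (fun x => complex.Re (f x)) /\
  C1_itv a b (fun x => complex.Im (f x)).

Definition csupp (f : R -> R[i]) : set R := closure [set x | f x != 0].

Definition Linfty_norm (f : R -> R[i]) : \bar R :=
  Lnorm (@lebesgue_measure R) +oo%E (fun x => (cmod (f x))%:E).

End complex_valued_functions.

Section tempered_distributions.
Context {R : realType}.

Definition schwartz (phi : R -> R[i]) : Prop :=
  csmooth phi /\
  forall j k : nat, exists M : R,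
    forall x, `|x| ^+ j * cmod (cderive1n k phi x) <= M.

(* The supremum is a real number whenever [phi] is a Schwartz function. *)
Definition schwartz_seminorm (j k : nat) (phi : R -> R[i]) : R :=
  sup (range (fun x => `|x| ^+ j * cmod (cderive1n k phi x))).

(* A distribution is encoded as a functional on all functions of which only
   the values at Schwartz functions are relevant. *)
Definition tempered (u : (R -> R[i]) -> R[i]) : Prop :=
  (forall (a : R[i]) (phi psi : R -> R[i]), schwartz phi -> schwartz psi ->
    u (fun x => a * phi x + psi x) = a * u phi + u psi) /\
  (exists (N : nat) (C : R), forall phi : R -> R[i], schwartz phi ->
    cmod (u phi) <= C * \sum_(j < N) \sum_(k < N) schwartz_seminorm j k phi).

Definition fourier (phi : R -> R[i]) (p : R) : R[i] :=
  cintegral (fun x => phi x * cis (- (x * p))).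

Definition fourier_distr (u : (R -> R[i]) -> R[i]) : (R -> R[i]) -> R[i] :=
  fun phi => u (fourier phi).

Definition distr_is_function (u : (R -> R[i]) -> R[i]) (g : R -> R[i]) : Prop :=
  clocally_integrable g /\
  forall phi, schwartz phi ->
    cintegrable (fun p => g p * phi p) /\
    u phi = cintegral (fun p => g p * phi p).

End tempered_distributions.

Section dispersive_equation.
Context {R : realType}.

Definition condition_C1 (p1 p2 mu : R) (Fu0 : R -> R[i]) : Prop :=
  csupp Fu0 `<=` `[p1, p2] /\
  exists util : R -> R[i],
    [/\ cC1_itv p1 p2 util,
        util p1 != 0 &
        forall p, p1 < p <= p2 ->
          Fu0 p = ((p - p1) `^ (mu - 1))%:C * util p].

(* The solution of i u_t = f(D) u whose initial datum has Fourier transform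
   [Fu0], for a real symbol [f]. *)
Definition solution (f : R -> R) (Fu0 : R -> R[i]) (t x : R) : R[i] :=
  ((2 * pi)^-1)%:C * cintegral (fun p => Fu0 p * cis (- (t * f p) + x * p)).

(* The symbol of - d^2/dx^2, for which i u_t = f(D) u is the free Schroedinger
   equation i u_t + u_xx = 0. *)
Definition fS (p : R) : R := p ^+ 2.

Definition uS (Fu0 : R -> R[i]) (t x : R) : R[i] := solution fS Fu0 t x.

End dispersive_equation.

(* Main.v *)
Require Import Defs.
From HB Require Import structures.
From mathcomp Require Import all_boot all_order all_algebra.
From mathcomp Require Import complex.
From mathcomp Require Import all_classical all_reals all_analysis.
From mathcomp Require Import measurable_realfun ess_sup_inf ring lra.

Set Implicit Arguments.
Unset Strict Implicit.
Unset Printing Implicit Defensive.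

Import Order.TTheory GRing.Theory Num.Theory.
Import numFieldNormedType.Exports.

Local Open Scope classical_set_scope.
Local Open Scope ring_scope.
Local Open Scope complex_scope.

(** On the frequency side the solution is an oscillatory integral over
    [p1, p2]. Completing the square in the phase, with a = x / (2 t) and
    d = t^(-1/2), turns it, up to a factor of modulus one, into
      integral of (p - p1)^(mu - 1) util(p) exp(- i ((p - a) / d)^2) dp,
    so that t^(- mu / 2) = d^mu and everything is a statement about small d.

    Upper bound (singular_chirp_bound). On [p1, p1 + d] the modulus of the
    integrand is already integrable with integral O(d^mu). On [p1 + d, p2] the
    amplitude is at most a multiple of d^(mu - 1) and its total variation is of
    the same order, while the primitives of a chirp of width d are O(d)
    uniformly in a and in the end points; the product is again O(d^mu).

    Optimality (singular_chirp_ge). Take x = 2 p1 t, so that the stationary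
    point a is the singular point p1. After multiplication by the conjugate of
    util(p1) and a rotation of the phase, the integral has a component equal to
      integral of (p - p1)^(mu - 1) G(p) sin(((p - p1) / d)^2) dp
    plus a similar term whose amplitude vanishes at p1, with
    G(p1) = |util(p1)|^2 > 0. One integration by parts, with the nonnegative
    primitive d^2 (1 - cos) / 2 of (p - p1) sin, leaves a nonnegative main term,
    a contribution of size d^mu from the region p - p1 ~ d, and errors
    O(d^(mu + 1/2)). A decay faster than t^(- mu / 2) would contradict this
    lower bound as d tends to 0. Since the norm is an essential supremum, the
    value at the single point x = 2 p1 t is reached through the continuity of
    the solution in x.

    All integrals are estimated by one device: a function H is compared with an
    explicit V by comparing derivatives in the open interval
    (primitive_on_le, primitive_on_norm_le). Applied to
    H(x) = integral over [p1, x] it bounds integrals that are singular at p1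
    without any improper integral, and applied to H minus a product it does the
    work of integration by parts without integrating the derivative of the
    amplitude. *)

(** * Comparison of functions through their derivatives *)

Section primitives.
Context {R : realType}.
Implicit Types (a b c d x : R) (f g F G H V : R -> R).

(** Derivatives are only required in the open interval and continuity up to the
    end points: this is what survives at a singular end point. *)
Definition primitive_on a b F f : Prop :=
  {within `[a, b], continuous F} /\
  forall x, a < x < b -> is_derive x 1 F (f x).

Lemma primitive_onS a b c d F f : a <= c -> d <= b ->
  primitive_on a b F f -> primitive_on c d F f.
Proof.
move=> ac db [cF dF]; split.
  by apply: continuous_subspaceW cF; apply: subset_itv; rewrite bnd_simp.
by move=> x /andP[cx xd]; apply: dF; rewrite (le_lt_trans ac cx) (lt_le_trans xd db).
Qed.

Lemma primitive_on_ext a b F f (f' : R -> R) : (forall x, a < x < b -> f x = f' x) ->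
  primitive_on a b F f -> primitive_on a b F f'.
Proof. by move=> ff' [cF dF]; split => // x xab; rewrite -ff'//; exact: dF. Qed.

Lemma primitive_on_derive a b F f :
  (forall x, a <= x <= b -> is_derive x 1 F (f x)) -> primitive_on a b F f.
Proof.
move=> dF; split; last first.
  by move=> x /andP[/ltW ax /ltW xb]; apply: dF; rewrite ax.
apply: derivable_within_continuous => x; rewrite in_itv/= => xab.
exact: (@ex_derive _ _ _ _ _ _ _ (dF x xab)).
Qed.

Lemma primitive_onD a b F f G g : primitive_on a b F f -> primitive_on a b G g ->
  primitive_on a b (fun x => F x + G x) (fun x => f x + g x).
Proof.
move=> [cF dF] [cG dG]; split.
  by move=> x; apply: continuousD; [exact: cF|exact: cG].
move=> x xab; have := dF x xab; have := dG x xab => ? ?; exact: is_deriveD.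
Qed.

Lemma primitive_onM a b F f G g : primitive_on a b F f -> primitive_on a b G g ->
  primitive_on a b (fun x => F x * G x) (fun x => f x * G x + F x * g x).
Proof.
move=> [cF dF] [cG dG]; split.
  by move=> x; apply: continuousM; [exact: cF|exact: cG].
move=> x xab; have := dF x xab; have := dG x xab => ? ?.
by apply: is_derive_eq; rewrite addrC /GRing.scale/= mulrC.
Qed.

Lemma primitive_on_cst a b c : primitive_on a b (fun=> c) (fun=> 0).
Proof. by apply: primitive_on_derive => x _; exact: is_derive_cst. Qed.

Lemma primitive_onZ a b c F f : primitive_on a b F f ->
  primitive_on a b (fun x => c * F x) (fun x => c * f x).
Proof.
move=> pF; have [? h] := primitive_onM (primitive_on_cst a b c) pF; split => //.
by move=> x /h; rewrite mul0r add0r.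
Qed.

Lemma primitive_onB a b F f G g : primitive_on a b F f -> primitive_on a b G g ->
  primitive_on a b (fun x => F x - G x) (fun x => f x - g x).
Proof.
move=> pF /(primitive_onZ (-1)) /(primitive_onD pF).
have E (u v : R -> R) : (fun x => u x + -1 * v x) = (fun x => u x - v x).
  by apply/funext => x; rewrite mulN1r.
by rewrite !E.
Qed.

Lemma primitive_on_le a b V v F f : a <= b ->
  primitive_on a b V v -> primitive_on a b F f ->
  (forall x, a < x < b -> v x <= f x) -> V b - V a <= F b - F a.
Proof.
rewrite le_eqVlt => /predU1P[<-|ab] pV pF vf; first by rewrite !subrr.
have [cG dG] := primitive_onB pF pV.
have dG' x : x \in `]a, b[ -> is_derive x 1 (fun x => F x - V x) (f x - v x).
  by rewrite in_itv/= => /dG.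
have [x xab] := MVT ab dG' cG.
move=> e; suff : 0 <= (f x - v x) * (b - a) by rewrite -e; lra.
by rewrite mulr_ge0 ?subr_ge0 ?(ltW ab)// vf// -in_itv.
Qed.

Lemma primitive_on_norm_le a b V v F f : a <= b ->
  primitive_on a b V v -> primitive_on a b F f ->
  (forall x, a < x < b -> `|f x| <= v x) -> `|F b - F a| <= V b - V a.
Proof.
move=> ab pV pF fv; rewrite ler_norml; apply/andP; split.
  rewrite lerNl; have := primitive_on_le ab (primitive_onZ (-1) pF) pV.
  rewrite !mulN1r opprB opprK addrC; apply => x /fv.
  by rewrite ler_norml => /andP[]; rewrite mulN1r; lra.
apply: (primitive_on_le ab pF pV) => x /fv; apply: le_trans; exact: ler_norm.
Qed.

(** Integrability makes the indefinite integral continuous up to the end points,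
    even where f is unbounded. *)
Lemma primitive_on_integral a b f : a <= b ->
  (@lebesgue_measure R).-integrable `[a, b] (EFin \o f) ->
  (forall x, a < x < b -> {for x, continuous f}) ->
  primitive_on a b (fun x => \int[lebesgue_measure]_(y in `[a, x]) f y) f.
Proof.
move=> ab intf cf; split; first exact: parameterized_integral_continuous.
move=> x /andP[ax xb].
have [dF eF] := continuous_FTC1_closed xb intf ax (cf x ltac:(by rewrite ax xb)).
by apply: DeriveDef; [exact: dF|rewrite -derive1E].
Qed.

Lemma is_derive_powRB p (r : R) x : p < x ->
  is_derive x 1 (fun y => (y - p) `^ r) (r * (x - p) `^ (r - 1)).
Proof.
move=> px; have px' : 0 < x - p by rewrite subr_gt0.
have h := is_derive1_powR r px'.
have h2 : is_derive x 1 (fun y => y - p) 1.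
  by apply: is_derive_eq; rewrite subr0.
have := @is_derive1_comp _ (fun z => z `^ r) (fun y => y - p) x _ _ h h2.
by rewrite mulr1.
Qed.

Lemma primitive_on_powRB p a b (r : R) : p < a ->
  primitive_on a b (fun x => (x - p) `^ r) (fun x => r * (x - p) `^ (r - 1)).
Proof.
move=> pa; apply: primitive_on_derive => x /andP[ax _].
by apply: is_derive_powRB; exact: lt_le_trans ax.
Qed.

(** For a positive exponent the power extends continuously to the base point,
    although its derivative may blow up there. *)
Lemma primitive_on_powRB0 p b (r : R) : 0 < r -> p < b ->
  primitive_on p b (fun x => (x - p) `^ r) (fun x => r * (x - p) `^ (r - 1)).
Proof.
move=> r0 pb; split; last by move=> x /andP[px _]; exact: is_derive_powRB.
have cx x : p < x -> {for x, continuous (fun x => (x - p) `^ r)}.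
  move=> px; apply: differentiable_continuous; apply/derivable1_diffP.
  exact: (@ex_derive _ _ _ _ _ _ _ (is_derive_powRB r px)).
apply/continuous_within_itvP => //; split.
- by move=> x; rewrite in_itv/= => /andP[px _]; exact: cx.
- rewrite subrr powR0 ?gt_eqF//.
  apply: (cvg_comp _ _ _ (powR_cvg0 r0)) => A [e e0 Ae].
  exists e => //= x xp px; apply: Ae => /=; last by rewrite subr_gt0.
  by rewrite sub0r normrN -normrN opprB.
- by apply: cvg_at_left_filter; exact: cx.
Qed.

End primitives.

(** * Elementary inequalities and the chirp corrector *)

Section elementary.
Context {R : realType}.
Implicit Types (x y r : R).

Lemma ler_powR_npos x y r : r <= 0 -> 0 < x -> x <= y -> y `^ r <= x `^ r.
Proof.
move=> r0 x0 xy; have y0 := lt_le_trans x0 xy.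
rewrite -[r]opprK [leLHS]powRN [leRHS]powRN lef_pV2 ?posrE ?powR_gt0//.
by apply: ge0_ler_powR; rewrite ?nnegrE ?oppr_ge0// ltW.
Qed.

Lemma powR_pred x r : 0 < x -> x `^ r = x * x `^ (r - 1).
Proof.
by move=> x0; rewrite -[X in X * _](powRr1 (ltW x0)) -powRD ?(gt_eqF x0) ?implybT// addrC subrK.
Qed.

Lemma sin_le_id x : 0 <= x -> sin x <= x.
Proof.
move=> x0.
have p1 : primitive_on 0 x sin cos.
  by apply: primitive_on_derive => y _; exact: is_derive_sin.
have p2 : primitive_on 0 x id (fun=> 1).
  by apply: primitive_on_derive => y _; exact: is_derive_id.
have := primitive_on_le x0 p1 p2; rewrite sin0 !subr0; apply => y _.
exact: cos_le1.
Qed.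

Lemma one_sub_cos_le x : 0 <= x -> 1 - cos x <= x ^+ 2 / 2.
Proof.
move=> x0.
have p1 : primitive_on 0 x (fun x => 1 - cos x) sin.
  apply: primitive_on_derive => y _.
  by apply: is_derive_eq; lra.
have p2 : primitive_on 0 x (fun x => x ^+ 2 / 2) id.
  apply: primitive_on_derive => y _.
  by apply: is_derive_eq; rewrite /GRing.scale/=; lra.
have := primitive_on_le x0 p1 p2.
rewrite cos0 subrr subr0 expr0n/= mul0r subr0; apply => y /andP[/ltW y0 _].
exact: sin_le_id.
Qed.

Lemma sin_ge_linear x : 0 <= x <= 4^-1 -> 7 / 8 * x <= sin x.
Proof.
move=> /andP[x0 x4].
have p1 : primitive_on 0 x (fun x => 7 / 8 * x) (fun=> 7 / 8).
  apply: primitive_on_derive => y _.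
  by apply: is_derive_eq; rewrite /GRing.scale/=; lra.
have p2 : primitive_on 0 x sin cos.
  by apply: primitive_on_derive => y _; exact: is_derive_sin.
have := primitive_on_le x0 p1 p2.
rewrite sin0 mulr0 !subr0; apply => y /andP[/ltW y0 yx].
have := one_sub_cos_le y0.
have : y ^+ 2 <= 4^-1 ^+ 2 by rewrite ler_sqr ?nnegrE//; lra.
lra.
Qed.

(** An approximate primitive of the chirp cos (y^2 + phi). The usual first step of
    integration by parts, sin (y^2 + phi) / (2 y), is singular at the stationary
    point; replacing 1 / y by y / (1 + y^2) removes the singularity at the price
    of an integrable error of order 1 / (1 + y^2), so that no splitting around
    the stationary point is needed. *)
Definition chirp_corrector (phi y : R) : R :=
  y * sin (y ^+ 2 + phi) / (2 * (1 + y ^+ 2)).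

Definition dchirp_corrector (phi y : R) : R :=
  cos (y ^+ 2 + phi) * y ^+ 2 / (1 + y ^+ 2) +
  sin (y ^+ 2 + phi) * (1 - y ^+ 2) / (2 * (1 + y ^+ 2) ^+ 2).

Lemma is_derive_chirp_corrector phi y :
  is_derive y 1 (chirp_corrector phi) (dchirp_corrector phi y).
Proof.
have y2 : 1 + y ^+ 2 != 0 by rewrite gt_eqF// ltr_pwDl// sqr_ge0.
have n0 : 2 * (1 + y ^+ 2) != 0 by rewrite mulf_neq0.
have d1 : is_derive y 1 (fun y => y ^+ 2 + phi) (2 * y).
  by apply: is_derive_eq; rewrite /GRing.scale/=; lra.
have d2 : is_derive y 1 (fun y => sin (y ^+ 2 + phi)) (cos (y ^+ 2 + phi) * (2 * y)).
  have := @is_derive1_comp _ sin (fun y => y ^+ 2 + phi) y _ _ (is_derive_sin _) d1.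
  exact.
have d3 : is_derive y 1 (fun y => 2 * (1 + y ^+ 2)) (4 * y).
  by apply: is_derive_eq; rewrite /GRing.scale/=; lra.
have d4 := @is_deriveV _ (fun y => 2 * (1 + y ^+ 2)) y _ _ n0 d3.
have d5 := is_deriveM (is_deriveM (@is_derive_id _ _ y 1) d2) d4.
apply: (is_derive_eq d5); rewrite /dchirp_corrector /GRing.scale mulrfctE/=.
by field.
Qed.

Lemma norm_chirp_corrector_le phi y : `|chirp_corrector phi y| <= 4^-1.
Proof.
have y2 : 0 < 1 + y ^+ 2 by rewrite ltr_pwDl// sqr_ge0.
rewrite /chirp_corrector normrM normfV [`|2 * _|]gtr0_norm ?mulr_gt0//.
rewrite ler_pdivrMr ?mulr_gt0// normrM.
apply: (@le_trans _ _ (`|y| * 1)); first by rewrite ler_wpM2l// sin_max.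
rewrite mulr1 -[y ^+ 2]real_normK ?num_real//.
have := sqr_ge0 (`|y| - 1); rewrite sqrrB1; lra.
Qed.

Lemma norm_cos_sub_dchirp_corrector_le phi y :
  `|cos (y ^+ 2 + phi) - dchirp_corrector phi y| <= 3 / 2 / (1 + y ^+ 2).
Proof.
have y2 : 0 < 1 + y ^+ 2 by rewrite ltr_pwDl// sqr_ge0.
have -> : cos (y ^+ 2 + phi) - dchirp_corrector phi y =
  (cos (y ^+ 2 + phi) - sin (y ^+ 2 + phi) * ((1 - y ^+ 2) / (1 + y ^+ 2)) / 2) / (1 + y ^+ 2).
  by rewrite /dchirp_corrector; field; rewrite gt_eqF.
rewrite normrM normfV (gtr0_norm y2) ler_pM2r ?invr_gt0//.
rewrite (le_trans (ler_normB _ _))//.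
have h : `|(1 - y ^+ 2) / (1 + y ^+ 2)| <= 1.
  rewrite normrM normfV (gtr0_norm y2) ler_pdivrMr// mul1r ler_norml.
  by have := sqr_ge0 y; lra.
have := cos_max (y ^+ 2 + phi).
suff : `|sin (y ^+ 2 + phi) * ((1 - y ^+ 2) / (1 + y ^+ 2)) / 2| <= 1 / 2 by lra.
rewrite normrM [`|2^-1|]gtr0_norm// ler_pM2r// normrM.
by rewrite mulr_ile1// sin_max.
Qed.

End elementary.

(** * Amplitudes with an algebraic singularity *)

Section singular_amplitudes.
Context {R : realType}.
Implicit Types (mu K : R) (F g w : R -> R).

Definition singular_amplitude mu K (p1 p2 : R) F g (g' : R -> R) : Prop :=
  [/\ (@lebesgue_measure R).-integrable `[p1, p2] (EFin \o F),
      forall p, p1 < p < p2 -> F p = (p - p1) `^ (mu - 1) * g p,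
      primitive_on p1 p2 g g',
      forall p, p1 <= p <= p2 -> `|g p| <= K &
      forall p, p1 < p < p2 -> `|g' p| <= K].

Lemma primitive_on_singular mu K p1 p2 F g g' w : p1 <= p2 ->
  singular_amplitude mu K p1 p2 F g g' ->
  continuous w -> (forall p, `|w p| <= 1) ->
  primitive_on p1 p2 (fun x => \int[lebesgue_measure]_(y in `[p1, x]) (F y * w y))
    (fun p => (p - p1) `^ (mu - 1) * g p * w p).
Proof.
move=> p12 [intF FE [cg dg] _ _] cw w1.
have FwE p : p1 < p < p2 -> F p * w p = (p - p1) `^ (mu - 1) * g p * w p.
  by move=> /FE ->.
apply: (primitive_on_ext FwE); apply: primitive_on_integral => //.
- apply: (integrableMl _ intF) => //.
  + by apply: measurable_funTS; apply: continuous_measurable_fun.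
  + exists 1; split => // M M1 x _ /=; exact: le_trans (w1 x) (ltW M1).
- move=> x xp; apply: cvgM; last exact: cw.
  apply: (@cvg_trans _ ((fun p => (p - p1) `^ (mu - 1) * g p) @ x)).
    apply: near_eq_cvg; near=> p; rewrite FE//.
    near: p; have : x \in `]p1, p2[ by rewrite in_itv.
    by move/near_in_itvoo; apply: filterS => p; rewrite in_itv.
  have c1 : {for x, continuous (fun p => (p - p1) `^ (mu - 1))}.
    apply: differentiable_continuous; apply/derivable1_diffP.
    have h := is_derive_powRB (mu - 1) (proj1 (andP xp)).
    exact: (@ex_derive _ _ _ _ _ _ _ h).
  have c2 : {for x, continuous g}.
    apply: differentiable_continuous; apply/derivable1_diffP.
    exact: (@ex_derive _ _ _ _ _ _ _ (dg x xp)).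
  by rewrite (FE x xp); exact: cvgM c1 c2.
Unshelve. all: by end_near. Qed.

End singular_amplitudes.

(** * Uniform upper bound for singular chirp integrals *)

Section dispersive_bound.
Context {R : realType}.
Implicit Types (mu K : R) (F g w : R -> R).

Lemma is_derive_rescale (a d p v : R) (f : R -> R) : d != 0 ->
  is_derive ((p - a) / d) 1 f v -> is_derive p 1 (fun p => d * f ((p - a) / d)) v.
Proof.
move=> d0 df.
have h : is_derive p 1 (fun p => (p - a) / d) d^-1.
  by apply: is_derive_eq; rewrite /GRing.scale/=; lra.
have h2 := @is_derive1_comp _ f (fun p => (p - a) / d) p _ _ df h.
have h3 : is_derive p 1 (fun p => f ((p - a) / d)) (v * d^-1) by exact: h2.
by apply: is_derive_eq; rewrite /GRing.scale/=; field.
Qed.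

Lemma primitive_on_powRBM (r q p1 p2 : R) g g' : p1 < q ->
  primitive_on q p2 g g' ->
  primitive_on q p2 (fun p => (p - p1) `^ r * g p)
    (fun p => r * (p - p1) `^ (r - 1) * g p + (p - p1) `^ r * g' p).
Proof. by move=> p1q pg; apply: primitive_onM pg; exact: primitive_on_powRB. Qed.

Lemma continuous_chirp (a d phi : R) : continuous (fun p => cos (((p - a) / d) ^+ 2 + phi)).
Proof.
move=> p; apply: continuous_comp; last exact: continuous_cos.
apply: (@continuousD _ R^o); last exact: cst_continuous.
have c1 : {for p, continuous (fun p => (p - a) / d)}.
  apply: (@continuousM R); last exact: cst_continuous.
  by apply: (@continuousB _ R^o); [exact: id|exact: cst_continuous].
exact: (@continuousM R _ _ _ _ c1 c1).
Qed.

Lemma singular_head mu K (p1 p2 c : R) F g g' w : 0 < mu -> p1 < c -> c <= p2 ->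
  singular_amplitude mu K p1 p2 F g g' ->
  continuous w -> (forall p, `|w p| <= 1) ->
  `|\int[lebesgue_measure]_(p in `[p1, c]) (F p * w p)| <= K * (c - p1) `^ mu / mu.
Proof.
move=> mu0 p1c cp2 sF cw w1.
have p12 : p1 <= p2 by rewrite (le_trans _ cp2)// ltW.
have pH := primitive_onS (lexx p1) cp2 (primitive_on_singular p12 sF cw w1).
have pV := primitive_onZ (K / mu) (primitive_on_powRB0 mu0 p1c).
have := primitive_on_norm_le (ltW p1c) pV pH.
rewrite set_itv1 Rintegral_set1 subr0 subrr powR0 ?gt_eqF// mulr0 subr0.
rewrite mulrAC; apply => p /andP[p1p pc].
have p0 : 0 < p - p1 by rewrite subr_gt0.
have -> : K / mu * (mu * (p - p1) `^ (mu - 1)) = (p - p1) `^ (mu - 1) * K * 1.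
  by field; rewrite gt_eqF.
have [_ _ _ gK _] := sF.
rewrite !normrM ger0_norm ?powR_ge0//.
apply: ler_pM => //; first by rewrite mulr_ge0// powR_ge0.
by apply: ler_wpM2l; [exact: powR_ge0|rewrite gK// ltW//= ltW// (lt_le_trans pc)].
Qed.

Definition chirp_integral F (a d phi b x : R) : R :=
  \int[lebesgue_measure]_(p in `[b, x]) (F p * cos (((p - a) / d) ^+ 2 + phi)).

(** Away from the singularity, integrate by parts against the rescaled corrector
    d * chirp_corrector. The error of the corrector is paid by
    d * atan ((p - a) / d), bounded by a multiple of d whatever a is; the
    derivative of the amplitude is dominated by K times that of
    (p - p1)^mu / mu - (p - p1)^(mu - 1). *)
Lemma singular_tail mu K (p1 p2 a d phi : R) F g g' : 0 < mu -> mu <= 1 ->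
  0 < d -> p1 + d < p2 -> 0 <= K ->
  singular_amplitude mu K p1 p2 F g g' ->
  `|chirp_integral F a d phi p1 p2 - chirp_integral F a d phi p1 (p1 + d)| <=
    K * d `^ mu * (7 + d `^ (1 - mu) * (p2 - p1) `^ mu / (4 * mu)).
Proof.
move=> mu0 mu1 d0 dp2 K0 sF; set H := chirp_integral F a d phi p1.
have d0' : d != 0 by rewrite gt_eqF.
have p1d : p1 < p1 + d by rewrite ltrDl.
have p1p2 : p1 < p2 by exact: lt_trans dp2.
have pH := primitive_onS (ltW p1d) (lexx p2) (primitive_on_singular (ltW p1p2) sF
  (@continuous_chirp a d phi) (fun p => cos_max _)).
have [_ _ pg gK g'K] := sF.
have pA := primitive_on_powRBM (mu - 1) p1d (primitive_onS (ltW p1d) (lexx p2) pg).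
have pW : primitive_on (p1 + d) p2 (fun p => d * chirp_corrector phi ((p - a) / d))
    (fun p => dchirp_corrector phi ((p - a) / d)).
  apply: primitive_on_derive => p _; apply: is_derive_rescale => //.
  exact: is_derive_chirp_corrector.
have pT : primitive_on (p1 + d) p2 (fun p => d * atan ((p - a) / d))
    (fun p => (1 + ((p - a) / d) ^+ 2)^-1).
  apply: primitive_on_derive => p _; exact: is_derive_rescale.
have pD := primitive_onB pH (primitive_onM pA pW).
have pV1 := primitive_onB (primitive_onZ mu^-1 (primitive_on_powRB p2 mu p1d))
   (primitive_on_powRB p2 (mu - 1) p1d).
have pV := primitive_onD (primitive_onZ (K * d `^ (mu - 1) * (3 / 2)) pT)
   (primitive_onZ (d / 4 * K) pV1).
have {pV pD} := primitive_on_norm_le (ltW dp2) pV pD.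
have powle p : p1 + d <= p -> (p - p1) `^ (mu - 1) <= d `^ (mu - 1).
  by move=> dp; apply: ler_powR_npos; rewrite ?subr_le0//; lra.
have dW y : `|d * chirp_corrector phi y| <= d / 4.
  by rewrite normrM gtr0_norm// ler_pM2l// norm_chirp_corrector_le.
have Kd p : p1 + d <= p <= p2 -> `|(p - p1) `^ (mu - 1) * g p| <= K * d `^ (mu - 1).
  move=> /andP[dp pp2]; rewrite normrM ger0_norm ?powR_ge0// mulrC.
  by apply: ler_pM; rewrite ?normr_ge0 ?powR_ge0 ?powle// gK// pp2 ltW// (lt_le_trans p1d).
set A := fun p => (p - p1) `^ (mu - 1) * g p in Kd *.
set W := fun p => d * chirp_corrector phi ((p - a) / d).
have AW p : p1 + d <= p <= p2 -> `|A p * W p| <= K * d `^ mu / 4.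
  move=> /Kd Ap; rewrite normrM (powR_pred mu d0).
  have -> : K * (d * d `^ (mu - 1)) / 4 = K * d `^ (mu - 1) * (d / 4) by field.
  by apply: ler_pM => //; exact: dW.
have AW1 : `|A p2 * W p2| <= K * d `^ mu / 4 by apply: AW; lra.
have AW2 : `|A (p1 + d) * W (p1 + d)| <= K * d `^ mu / 4 by apply: AW; lra.
move=> h.
have {}h : `|H p2 - A p2 * W p2 - (H (p1 + d) - A (p1 + d) * W (p1 + d))| <=
   K * d `^ (mu - 1) * (3 / 2) * (d * atan ((p2 - a) / d)) +
    d / 4 * K * (mu^-1 * (p2 - p1) `^ mu - (p2 - p1) `^ (mu - 1)) -
   (K * d `^ (mu - 1) * (3 / 2) * (d * atan ((p1 + d - a) / d)) +
   d / 4 * K * (mu^-1 * (p1 + d - p1) `^ mu - (p1 + d - p1) `^ (mu - 1))).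
  apply: h => p /andP[dp pp2].
  have p0 : 0 < p - p1 by rewrite subr_gt0 (lt_trans p1d).
  set y := (p - a) / d.
  set q1 := (p - p1) `^ (mu - 1); set q2 := (p - p1) `^ (mu - 1 - 1).
  have -> : q1 * g p * cos (y ^+ 2 + phi) -
     (((mu - 1) * q2 * g p + q1 * g' p) * (d * chirp_corrector phi y) +
       q1 * g p * dchirp_corrector phi y) =
     q1 * g p * (cos (y ^+ 2 + phi) - dchirp_corrector phi y) +
     (((1 - mu) * q2 * g p - q1 * g' p) * (d * chirp_corrector phi y)) by ring.
  apply: (le_trans (ler_normD _ _)); apply: lerD.
    rewrite normrM -mulrA; apply: ler_pM; rewrite ?normr_ge0//.
      by apply: Kd; rewrite !ltW.
    exact: norm_cos_sub_dchirp_corrector_le.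
  rewrite normrM mulrC.
  have -> : d / 4 * K * (mu^-1 * (mu * q1) - (mu - 1) * q2) =
    d / 4 * (q1 * K + (1 - mu) * q2 * K) by field; rewrite gt_eqF.
  apply: ler_pM; rewrite ?normr_ge0//.
  have p12p : p1 < p < p2 by rewrite -subr_gt0 p0.
  apply: (le_trans (ler_normB _ _)); rewrite addrC; apply: lerD.
    rewrite normrM ger0_norm ?powR_ge0//.
    by apply: ler_wpM2l; rewrite ?powR_ge0// g'K.
  rewrite 2!normrM [`|q2|]ger0_norm ?powR_ge0// [`|1 - mu|]ger0_norm ?subr_ge0//.
  apply: ler_wpM2l; first by rewrite mulr_ge0 ?powR_ge0 ?subr_ge0.
  by apply: gK; case/andP: p12p => ? ?; rewrite !ltW.
have at1 := atan_ltpi2 ((p2 - a) / d).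
have at2 := atan_gtNpi2 ((p1 + d - a) / d).
have pi4 := @pihalf_lt2 R.
have E1 : (p1 + d - p1) = d by ring.
have Kdm : 0 <= K * d `^ mu by rewrite mulr_ge0// powR_ge0.
have Kdat : K * d `^ mu * (atan ((p2 - a) / d) - atan ((p1 + d - a) / d)) <= K * d `^ mu * 4.
  by rewrite ler_wpM2l//; lra.
have dK : 0 <= d / 4 * K by rewrite mulr_ge0//; lra.
have L1 : 0 <= d / 4 * K * (p2 - p1) `^ (mu - 1) by rewrite mulr_ge0 ?powR_ge0.
have L2 : 0 <= d / 4 * K * (mu^-1 * d `^ mu).
  by rewrite mulr_ge0// mulr_ge0 ?powR_ge0// invr_ge0 ltW.
have Ed := powR_pred mu d0.
have Ed2 : d = d `^ mu * d `^ (1 - mu).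
  rewrite -powRD; last by rewrite d0' implybT.
  by rewrite addrCA subrr addr0 powRr1// ltW.
have L3 : d / 4 * K * (mu^-1 * (p2 - p1) `^ mu) =
    K * d `^ mu * (d `^ (1 - mu) * (p2 - p1) `^ mu / (4 * mu)).
  by rewrite [X in X / 4]Ed2; field; rewrite gt_eqF.
have L4 x : K * d `^ (mu - 1) * (3 / 2) * (d * x) = 3 / 2 * (K * d `^ mu * x).
  by rewrite Ed; ring.
have L5 : d / 4 * K * d `^ (mu - 1) = K * d `^ mu / 4 by rewrite Ed; ring.
rewrite E1 !L4 !mulrBr L3 L5 in h.
rewrite mulrBr in Kdat.
rewrite mulrDr.
have -> : H p2 - H (p1 + d) = (H p2 - A p2 * W p2 - (H (p1 + d) - A (p1 + d) * W (p1 + d)))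
   + (A p2 * W p2 - A (p1 + d) * W (p1 + d)) by ring.
apply: (le_trans (ler_normD _ _)).
have := ler_normB (A p2 * W p2) (A (p1 + d) * W (p1 + d)).
lra.
Qed.

(** The interval is cut at p1 + d, where the bounds of both sides are of order
    d^mu; when p1 + d >= p2 the head alone suffices. *)
Lemma singular_chirp_bound mu K (p1 p2 : R) F g g' : 0 < mu -> mu <= 1 -> p1 < p2 ->
  0 <= K -> singular_amplitude mu K p1 p2 F g g' ->
  exists2 C : R, 0 <= C & forall d a phi : R, 0 < d -> d <= 1 ->
  `|chirp_integral F a d phi p1 p2| <= C * d `^ mu.
Proof.
move=> mu0 mu1 p12 K0 sF.
exists (K / mu + K * (7 + (p2 - p1) `^ mu / (4 * mu))).
  by rewrite addr_ge0// ?divr_ge0 ?mulr_ge0 ?addr_ge0 ?divr_ge0 ?powR_ge0 ?mulr_ge0// ltW.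
move=> d a phi d0 d1.
have KL : 0 <= K * (7 + (p2 - p1) `^ mu / (4 * mu)).
  by rewrite mulr_ge0// addr_ge0// divr_ge0 ?powR_ge0// mulr_ge0// ltW.
have [dp2|dp2] := lerP p2 (p1 + d).
  have h := @singular_head mu K p1 p2 p2 F g g' _ mu0 p12 (lexx _) sF
    (@continuous_chirp a d phi) (fun p => cos_max _).
  apply: (le_trans h); rewrite mulrDl -[leLHS]addr0; apply: lerD.
    rewrite [leLHS]mulrAC; apply: ler_wpM2l; first by rewrite divr_ge0// ltW.
    by apply: ge0_ler_powR; rewrite ?nnegrE; lra.
  by rewrite mulr_ge0// powR_ge0.
have h := @singular_head mu K p1 p2 (p1 + d) F g g' _ mu0
   ltac:(by rewrite ltrDl) (ltW dp2) sF
    (@continuous_chirp a d phi) (fun p => cos_max _).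
have h2 := @singular_tail mu K p1 p2 a d phi F g g' mu0 mu1 d0 dp2 K0 sF.
rewrite -/(chirp_integral F a d phi p1 _) in h.
set H1 := chirp_integral _ _ _ _ _ _ in h h2.
set H2 := chirp_integral _ _ _ _ _ _ in h2 *.
rewrite addrAC subrr add0r in h.
have -> : H2 = (H2 - H1) + H1 by ring.
apply: (le_trans (ler_normD _ _)).
rewrite mulrDl addrC; apply: lerD.
  by apply: (le_trans h); rewrite mulrAC.
apply: (le_trans h2); rewrite {h2}.
rewrite mulrAC; apply: ler_wpM2r; first exact: powR_ge0.
apply: ler_wpM2l => //; rewrite lerD2l; apply: ler_wpM2r; first by rewrite invr_ge0 mulr_ge0// ltW.
rewrite -[leRHS]mul1r; apply: ler_wpM2r; first exact: powR_ge0.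
by rewrite -[leRHS](powRr0 d); apply: ger_powR; rewrite ?d0//; lra.
Qed.

End dispersive_bound.

(** * Lower bound at a stationary point on the singularity *)

Section lower_bound.
Context {R : realType}.
Implicit Types (mu K : R) (F g w : R -> R).

(** The primitives of (p - b) cos (((p - b) / d)^2 + phi); the free constant s lets
    one choose a primitive of constant sign. *)
Definition chirp_primitive (b d phi s p : R) : R :=
  d ^+ 2 / 2 * (s + sin (((p - b) / d) ^+ 2 + phi)).

Lemma is_derive_chirp_primitive (b d phi s p : R) : d != 0 ->
  is_derive p 1 (chirp_primitive b d phi s)
    ((p - b) * cos (((p - b) / d) ^+ 2 + phi)).
Proof.
move=> d0.
have h : is_derive p 1 (fun p => ((p - b) / d) ^+ 2 + phi) (2 * (p - b) / d ^+ 2).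
  by apply: is_derive_eq; rewrite /GRing.scale/=; field.
have h2 := @is_derive1_comp _ sin (fun p => ((p - b) / d) ^+ 2 + phi) p _ _
  (is_derive_sin _) h.
have h3 : is_derive p 1 (fun p => sin (((p - b) / d) ^+ 2 + phi))
  (cos (((p - b) / d) ^+ 2 + phi) * (2 * (p - b) / d ^+ 2)) by exact: h2.
by apply: is_derive_eq; rewrite /GRing.scale/=; field.
Qed.

Lemma norm_chirp_primitive_le (b d phi s p : R) : `|s| <= 1 ->
  `|chirp_primitive b d phi s p| <= d ^+ 2.
Proof.
move=> s1; rewrite normrM ger0_norm ?divr_ge0 ?sqr_ge0//.
apply: (@le_trans _ _ (d ^+ 2 / 2 * 2)); last by rewrite divfK.
apply: ler_wpM2l; first by rewrite divr_ge0 ?sqr_ge0.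
apply: (le_trans (ler_normD _ _)).
by have := sin_max (((p - b) / d) ^+ 2 + phi); lra.
Qed.

(** Writing the amplitude as (p - p1)^(mu - 2) g times the factor p - p1 that
    chirp_primitive absorbs, integration by parts produces
    (2 - mu) (p - p1)^(mu - 3) G0 E >= 0, which is dropped, and terms bounded by
    3 K d^2 (p - p1)^(mu - 2). Trading (p - p1)^(mu - 3/2) for its value at
    p - p1 = d / 2 and integrating the remaining (p - p1)^(-1/2) gives a
    power d^(mu + 1/2) for all mu in (0, 1], with no logarithm at mu = 1. *)
Lemma singular_tail_ge mu K (p1 p2 d phi s G0 : R) F g g' :
  0 < mu -> mu <= 1 -> 0 < d -> p1 + d / 2 < p2 -> 0 <= K ->
  singular_amplitude mu K p1 p2 F g g' ->
  (forall p, p1 <= p <= p2 -> `|g p - G0| <= K * (p - p1)) ->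
  `|s| <= 1 -> (forall y, 0 <= G0 * (s + sin (y + phi))) ->
  let B p := (p - p1) `^ (mu - 1 - 1) * g p * chirp_primitive p1 d phi s p in
  let H := chirp_integral F p1 d phi p1 in
  B p2 - B (p1 + d / 2) - 24 * K * (p2 - p1) `^ 2^-1 * d `^ (mu + 2^-1) <=
  H p2 - H (p1 + d / 2).
Proof.
move=> mu0 mu1 d0 dp2 K0 sF gG0 s1 Gs; cbv zeta.
set H := chirp_integral F p1 d phi p1.
set E := chirp_primitive p1 d phi s.
have d0' : d != 0 by rewrite gt_eqF.
have d20 : 0 < d / 2 by rewrite divr_gt0.
have p1d : p1 < p1 + d / 2 by rewrite ltrDl.
have p1p2 : p1 < p2 by exact: lt_trans dp2.
have pH := primitive_onS (ltW p1d) (lexx p2) (primitive_on_singular (ltW p1p2) sF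
  (@continuous_chirp _ p1 d phi) (fun p => cos_max _)).
have [_ _ pg gK g'K] := sF.
have pA := primitive_on_powRBM (mu - 1 - 1) p1d (primitive_onS (ltW p1d) (lexx p2) pg).
have pE : primitive_on (p1 + d / 2) p2 E (fun p => (p - p1) * cos (((p - p1) / d) ^+ 2 + phi)).
  by apply: primitive_on_derive => p _; exact: is_derive_chirp_primitive.
have pD := primitive_onB pH (primitive_onM pA pE).
set k := K * d ^+ 2 * (d / 2) `^ (mu - 1 - 2^-1).
have k0 : 0 <= k by rewrite mulr_ge0 ?powR_ge0// mulr_ge0 ?sqr_ge0.
have pV := primitive_onZ (- (6 * k)) (primitive_on_powRB p2 2^-1 p1d).
have := primitive_on_le (ltW dp2) pV pD.
rewrite -/(chirp_integral F p1 d phi p1 _).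
move=> h.
have {h} : - (6 * k) * (p2 - p1) `^ 2^-1 - - (6 * k) * (p1 + d / 2 - p1) `^ 2^-1 <=
  H p2 - (p2 - p1) `^ (mu - 1 - 1) * g p2 * E p2 -
  (H (p1 + d / 2) - (p1 + d / 2 - p1) `^ (mu - 1 - 1) * g (p1 + d / 2) * E (p1 + d / 2)).
  apply: h => p /andP[dp pp2].
  have q0 : 0 < p - p1 by rewrite subr_gt0 (lt_trans p1d).
  have p12p : p1 < p < p2 by rewrite -subr_gt0 q0.
  have p12p' : p1 <= p <= p2 by case/andP: p12p => ? ?; rewrite !ltW.
  rewrite (powR_pred (mu - 1) q0) (powR_pred (mu - 1 - 1) q0).
  set q := p - p1 in q0 *; set q3 := q `^ (mu - 1 - 1 - 1).
  set c := cos _.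
  have q30 : 0 <= q3 by exact: powR_ge0.
  have EN : `|E p| <= d ^+ 2 by exact: norm_chirp_primitive_le.
  have GE : 0 <= G0 * E p.
    by rewrite /E /chirp_primitive mulrCA mulr_ge0// divr_ge0// sqr_ge0.
  have b1 : `|(2 - mu) * q3 * ((g p - G0) * E p)| <= 2 * (K * q * q3 * d ^+ 2).
    rewrite 2!normrM [`|q3|]ger0_norm// ger0_norm; last by lra.
    have -> : 2 * (K * q * q3 * d ^+ 2) = 2 * q3 * (K * q * d ^+ 2) by ring.
    rewrite normrM; apply: ler_pM; rewrite ?mulr_ge0//; first by lra.
      by apply: ler_wpM2r => //; lra.
    by apply: ler_pM => //; exact: gG0.
  have b2 : `|q * q3 * g' p * E p| <= K * q * q3 * d ^+ 2.
    rewrite 2!normrM ger0_norm ?mulr_ge0 ?(ltW q0)//.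
    apply: ler_pM; rewrite ?mulr_ge0 ?(ltW q0)// -mulrA mulrC.
    by apply: ler_wpM2r; rewrite ?mulr_ge0 ?(ltW q0)// g'K.
  have b3 : 0 <= (2 - mu) * q3 * (G0 * E p).
    by rewrite mulr_ge0// mulr_ge0//; lra.
  have e3 : q * q3 <= (d / 2) `^ (mu - 1 - 2^-1) * q `^ (2^-1 - 1).
    rewrite -powR_pred//.
    have -> : mu - 1 - 1 = (mu - 1 - 2^-1) + (2^-1 - 1) by lra.
    rewrite powRD; last by rewrite (gt_eqF q0) implybT.
    apply: ler_wpM2r; first exact: powR_ge0.
    by apply: ler_powR_npos => //; rewrite /q; lra.
  have e4 : K * q * q3 * d ^+ 2 <= k * q `^ (2^-1 - 1).
    have -> : K * q * q3 * d ^+ 2 = K * d ^+ 2 * (q * q3) by ring.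
    by rewrite /k -[leRHS]mulrA; apply: ler_wpM2l => //; rewrite mulr_ge0 ?sqr_ge0.
  have -> : q * (q * q3) * g p * c - (((mu - 1 - 1) * q3 * g p + q * q3 * g' p) * E p
     + q * q3 * g p * (q * c)) =
     (2 - mu) * q3 * ((g p - G0) * E p) + (2 - mu) * q3 * (G0 * E p) - q * q3 * g' p * E p.
    by ring.
  move: b1 b2; rewrite !ler_norml => /andP[b1 _] /andP[_ b2].
  lra.
have kd : 6 * k <= 24 * K * d `^ (mu + 2^-1).
  rewrite /k.
  have -> : d ^+ 2 = d `^ 2 by rewrite -powR_mulrn// ltW.
  have -> : d `^ (mu + 2^-1) = d `^ 2 * d `^ (mu - 1 - 2^-1).
    rewrite -powRD; last by rewrite d0' implybT.
    by congr (_ `^ _); lra.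
  rewrite powRM//; last by rewrite ltW.
  have h2 : 2^-1 `^ (mu - 1 - 2^-1) <= 4 :> R.
    rewrite -[X in X `^ _](@powR_inv1 _ 2)// -powRrM.
    have -> : 4 = 2 `^ 2 :> R by rewrite powR_mulrn// expr2; lra.
    by apply: ler_powR; lra.
  have : 0 <= K * d `^ 2 * d `^ (mu - 1 - 2^-1) by rewrite !mulr_ge0 ?powR_ge0.
  set x := d `^ 2; set y := d `^ _; set z := 2^-1 `^ _ => xy0.
  have : K * x * y * z <= K * x * y * 4 by apply: ler_wpM2l.
  lra.
have L0 : 0 <= (p2 - p1) `^ 2^-1 by exact: powR_ge0.
have kd' := ler_wpM2r L0 kd.
have k' : 0 <= 6 * k * (p1 + d / 2 - p1) `^ 2^-1.
  by rewrite mulr_ge0 ?powR_ge0// mulr_ge0.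
have -> : 24 * K * (p2 - p1) `^ 2^-1 * d `^ (mu + 2^-1) =
  24 * K * d `^ (mu + 2^-1) * (p2 - p1) `^ 2^-1 by ring.
lra.
Qed.

End lower_bound.

Section lower_bound_total.
Context {R : realType}.
Implicit Types (mu K : R) (F g w : R -> R).

(** Here k measures how fast G0 cos (y + phi) grows from y = 0: it is 0 in the
    degenerate case G0 = 0, and a fraction of G0 for the sine. *)
Lemma singular_head_ge mu K (p1 p2 c d phi k G0 : R) F g g' :
  0 < mu -> 0 < d -> p1 < c -> c <= p1 + d / 2 -> c <= p2 ->
  singular_amplitude mu K p1 p2 F g g' ->
  (forall p, p1 <= p <= p2 -> `|g p - G0| <= K * (p - p1)) ->
  (forall y, 0 <= y <= 4^-1 -> k * y <= G0 * cos (y + phi)) ->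
  k / d ^+ 2 / (mu + 2) * (c - p1) `^ (mu + 2) - K / (mu + 1) * (c - p1) `^ (mu + 1) <=
  chirp_integral F p1 d phi p1 c.
Proof.
move=> mu0 d0 p1c cd cp2 sF gG0 kG.
have p12 : p1 <= p2 by rewrite (le_trans _ cp2)// ltW.
have pH := primitive_onS (lexx p1) cp2 (primitive_on_singular p12 sF
  (@continuous_chirp _ p1 d phi) (fun p => cos_max _)).
have mu1 : 0 < mu + 1 by lra.
have mu2 : 0 < mu + 2 by lra.
have pV := primitive_onB
  (primitive_onZ (k / d ^+ 2 / (mu + 2)) (primitive_on_powRB0 mu2 p1c))
  (primitive_onZ (K / (mu + 1)) (primitive_on_powRB0 mu1 p1c)).
have := primitive_on_le (ltW p1c) pV pH.
rewrite set_itv1 Rintegral_set1 !subr0 subrr !powR0 ?gt_eqF// !mulr0 !subr0.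
apply => p /andP[p1p pc].
have q0 : 0 < p - p1 by rewrite subr_gt0.
have -> : mu + 2 - 1 = mu + 1 by ring.
rewrite (powR_pred (mu + 1) q0) addrK (powR_pred mu q0).
set q := p - p1 in q0 *; set q1 := q `^ (mu - 1); set w := cos _.
have q10 : 0 <= q1 by exact: powR_ge0.
have kw : k * (q / d) ^+ 2 <= G0 * w.
  apply: kG; rewrite sqr_ge0/=.
  have -> : 4^-1 = 2^-1 ^+ 2 :> R by field.
  rewrite ler_sqr ?nnegrE ?divr_ge0 ?invr_ge0 ?(ltW q0) ?(ltW d0)//.
  by rewrite ler_pdivrMr// /q; lra.
have gw : - (K * q) <= (g p - G0) * w.
  have : `|(g p - G0) * w| <= K * q.
    rewrite normrM -[leRHS]mulr1; apply: ler_pM => //; last exact: cos_max.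
    by apply: gG0; rewrite ltW//= ltW// (lt_le_trans pc).
  by rewrite ler_norml => /andP[].
have -> : k / d ^+ 2 / (mu + 2) * ((mu + 2) * (q * (q * q1))) -
    K / (mu + 1) * ((mu + 1) * (q * q1)) = q1 * (k * (q / d) ^+ 2 - K * q).
  by field; rewrite !gt_eqF.
have -> : q1 * g p * w = q1 * (G0 * w + (g p - G0) * w) by ring.
apply: ler_wpM2l => //; lra.
Qed.

(** The gain of the head at p - p1 = d / 2 is at least k / 12 (d / 2)^mu; the boundary
    term of the tail at that point costs at most k / 14 (d / 2)^mu, which is what
    the hypothesis on s + sin (1 / 4 + phi) expresses, 1 / 4 being the value of
    ((p - p1) / d)^2 there. The difference is k / 84 (d / 2)^mu. With k = 0 the
    statement says that an amplitude vanishing at p1 contributes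
    O(d^(mu + 1/2)). *)
Lemma singular_chirp_ge mu K (p1 p2 phi s k G0 : R) F g g' :
  0 < mu -> mu <= 1 -> p1 < p2 -> 0 <= K -> 0 <= k ->
  singular_amplitude mu K p1 p2 F g g' ->
  (forall p, p1 <= p <= p2 -> `|g p - G0| <= K * (p - p1)) ->
  `|s| <= 1 -> (forall y, 0 <= G0 * (s + sin (y + phi))) ->
  (forall y, 0 <= y <= 4^-1 -> k * y <= G0 * cos (y + phi)) ->
  G0 * (s + sin (4^-1 + phi)) <= k / 28 ->
  exists2 C : R, 0 <= C & forall d : R, 0 < d -> d <= 1 -> p1 + d / 2 < p2 ->
  k / 168 * d `^ mu - C * d `^ (mu + 2^-1) <= chirp_integral F p1 d phi p1 p2.
Proof.
move=> mu0 mu1 p12 K0 k0 sF gG0 s1 Gs kG kE.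
pose C := K * (5 + (p2 - p1) `^ (mu - 1) + 24 * (p2 - p1) `^ 2^-1).
exists C; first by rewrite mulr_ge0// !addr_ge0// ?mulr_ge0 ?powR_ge0.
move=> d d0 d1 dp2.
have d20 : 0 < d / 2 by rewrite divr_gt0.
have p1d : p1 < p1 + d / 2 by rewrite ltrDl.
have tail := singular_tail_ge mu0 mu1 d0 dp2 K0 sF gG0 s1 Gs.
have head := singular_head_ge mu0 d0 p1d (lexx _) (ltW dp2) sF gG0 kG.
have d0' : d != 0 by rewrite gt_eqF.
have EcE : chirp_primitive p1 d phi s (p1 + d / 2) = d ^+ 2 / 2 * (s + sin (4^-1 + phi)).
  rewrite /chirp_primitive; congr (_ * (_ + sin (_ + _))).
  by rewrite addrAC subrr add0r; field.
move: tail head; cbv zeta.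
have -> : p1 + d / 2 - p1 = d / 2 by ring.
set H2 := chirp_integral _ _ _ _ _ p2; set H1 := chirp_integral _ _ _ _ _ _.
set E := chirp_primitive p1 d phi s in EcE *.
have EN p : `|E p| <= d ^+ 2 by exact: norm_chirp_primitive_le.
have GE p : 0 <= G0 * E p.
  by rewrite /E /chirp_primitive mulrCA mulr_ge0// divr_ge0// sqr_ge0.
have gE p : p1 <= p <= p2 -> `|(g p - G0) * E p| <= K * (p - p1) * d ^+ 2.
  by move=> pp; rewrite normrM; apply: ler_pM => //; exact: gG0.
have D2 : d ^+ 2 <= d `^ (mu + 2^-1).
  by rewrite -powR_mulrn ?(ltW d0)//; apply: ger_powR; rewrite ?d0//; lra.
have D1 : (d / 2) `^ (mu + 1) <= d `^ (mu + 2^-1).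
  apply: (@le_trans _ _ (d `^ (mu + 1))).
    by apply: ge0_ler_powR; rewrite ?nnegrE; lra.
  by apply: ger_powR; rewrite ?d0//; lra.
set x := d `^ (mu + 2^-1) in D2 D1 *.
have Dm : d `^ mu / 2 <= (d / 2) `^ mu.
  rewrite powRM ?(ltW d0)//; apply: ler_wpM2l; first exact: powR_ge0.
  by apply: ger1_powR => //; lra.
have L0 : 0 < p2 - p1 by rewrite subr_gt0.
have B2 : - (K * (p2 - p1) `^ (mu - 1) * x) <= (p2 - p1) `^ (mu - 1 - 1) * g p2 * E p2.
  have h : `|(g p2 - G0) * E p2| <= K * (p2 - p1) * d ^+ 2.
    by apply: gE; rewrite lexx ltW.
  rewrite (powR_pred (mu - 1) L0).
  set P := (p2 - p1) `^ _.
  have P0 : 0 <= P by exact: powR_ge0.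
  have -> : P * g p2 * E p2 = P * (G0 * E p2 + (g p2 - G0) * E p2) by ring.
  have -> : - (K * ((p2 - p1) * P) * x) = P * - (K * (p2 - p1) * x) by ring.
  apply: ler_wpM2l => //.
  have h2 : K * (p2 - p1) * d ^+ 2 <= K * (p2 - p1) * x.
    by apply: ler_wpM2l => //; rewrite mulr_ge0// ltW.
  have := GE p2; move: h; rewrite ler_norml => /andP[h _]; lra.
have Ed1 := powR_pred (mu - 1) d20.
have Ed0 := powR_pred mu d20.
have Ed3 := powR_pred (mu + 1) d20; rewrite addrK in Ed3.
have Ed4 := powR_pred (mu + 2) d20.
have emu : mu + 2 - 1 = mu + 1 by ring.
rewrite emu in Ed4.
have B1 : (d / 2) `^ (mu - 1 - 1) * g (p1 + d / 2) * E (p1 + d / 2) <=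
    k / 14 * (d / 2) `^ mu + 4 * K * x.
  have h : `|(g (p1 + d / 2) - G0) * E (p1 + d / 2)| <= K * (d / 2) * d ^+ 2.
    have := gE (p1 + d / 2); rewrite [X in K * X]addrAC subrr add0r; apply.
    by rewrite !ltW.
  have h3 : G0 * E (p1 + d / 2) <= d ^+ 2 / 2 * (k / 28).
    by rewrite EcE mulrCA ler_wpM2l// divr_ge0 ?sqr_ge0.
  set P := (d / 2) `^ (mu - 1 - 1) in Ed1 *.
  have P0 : 0 <= P by exact: powR_ge0.
  have h4 : 4 * K * (d / 2) `^ (mu + 1) <= 4 * K * x.
    by apply: ler_wpM2l => //; rewrite mulr_ge0.
  have -> : P * g (p1 + d / 2) * E (p1 + d / 2) =
     P * (G0 * E (p1 + d / 2) + (g (p1 + d / 2) - G0) * E (p1 + d / 2)) by ring.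
  have h5 : P * (G0 * E (p1 + d / 2) + (g (p1 + d / 2) - G0) * E (p1 + d / 2)) <=
     P * (d ^+ 2 / 2 * (k / 28) + K * (d / 2) * d ^+ 2).
    apply: ler_wpM2l => //; apply: lerD => //.
    by move: h; rewrite ler_norml => /andP[].
  apply: (le_trans h5); apply: le_trans (lerD (lexx _) h4).
  by rewrite Ed3 Ed0 Ed1 le_eqVlt; apply/orP; left; apply/eqP; field.
move=> tail head.
have A1 : k / d ^+ 2 / (mu + 2) * (d / 2) `^ (mu + 2) >= k / 12 * (d / 2) `^ mu.
  rewrite Ed4 Ed3.
  have -> : k / d ^+ 2 / (mu + 2) * (d / 2 * (d / 2 * (d / 2) `^ mu)) =
     k / 4 * (d / 2) `^ mu / (mu + 2) by field; rewrite d0' gt_eqF//; lra.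
  rewrite ler_pdivlMr; last by lra.
  have : 0 <= k * (d / 2) `^ mu by rewrite mulr_ge0 ?powR_ge0.
  set z := _ `^ _ => kz; have := ler_wpM2l kz mu1; lra.
have A2 : K / (mu + 1) * (d / 2) `^ (mu + 1) <= K * x.
  apply: ler_pM; rewrite ?powR_ge0 ?divr_ge0//; first by lra.
  by rewrite ler_pdivrMr; [rewrite ler_peMr//; lra|lra].
have A3 : k / 84 * (d `^ mu / 2) <= k / 84 * (d / 2) `^ mu.
  by apply: ler_wpM2l => //; rewrite divr_ge0.
have -> : C * x = 5 * (K * x) + K * (p2 - p1) `^ (mu - 1) * x +
   24 * K * (p2 - p1) `^ 2^-1 * x by rewrite /C; ring.
lra.
Qed.

End lower_bound_total.

(** * Continuously differentiable functions on a closed interval *)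

Section C1_amplitudes.
Context {R : realType}.

(** A difference quotient that converges is bounded near the point, which gives
    continuity, at the end points included. *)
Lemma C1_itv_primitive_on (a b : R) (f : R -> R) : C1_itv a b f ->
  exists2 f', {within `[a, b], continuous f'} & primitive_on a b f f'.
Proof.
move=> [f' cf' df]; exists f' => //; split.
  apply/subspace_continuousP => x xab.
  have /cvgrPdist_lt/(_ 1 ltr01)[e /= e0 he] := df x xab.
  apply/cvgrPdist_lt => r r0.
  have k0 : 0 < `|f' x| + 1 by rewrite ltr_wpDl.
  exists (Num.min e (r / (`|f' x| + 1))) => /=.
    by rewrite lt_min e0 divr_gt0.
  move=> y; rewrite /ball_/= lt_min => /andP[xye xyr] yab.
  have [<-|yx] := eqVneq x y; first by rewrite subrr normr0.
  have := he y xye; rewrite eq_sym => /(_ yx yab) h.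
  have yx0 : y - x != 0 by rewrite subr_eq0 eq_sym.
  have -> : f x - f y = - ((f y - f x) / (y - x) * (y - x)) by rewrite divfK// opprB.
  rewrite normrN normrM.
  have h1 : `|(f y - f x) / (y - x)| <= `|f' x| + 1.
    have -> : (f y - f x) / (y - x) = f' x - (f' x - (f y - f x) / (y - x)).
      by rewrite subKr.
    by apply: (le_trans (ler_normB _ _)); rewrite lerD2l ltW.
  apply: (@le_lt_trans _ _ ((`|f' x| + 1) * `|y - x|)).
    by apply: ler_wpM2r.
  by rewrite mulrC -ltr_pdivlMr// distrC.
move=> x xab.
have xab' : x \in `[a, b].
  by case/andP: xab => ax xb; rewrite in_itv/= !ltW.
have cvgd : h^-1 *: (f (h *: 1 + x) - f x) @[h --> 0^'] --> f' x.
  apply/cvgrPdist_lt => r r0.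
  have /cvgrPdist_lt/(_ r r0)[e /= e0 he] := df x xab'.
  have : x \in `]a, b[ by rewrite in_itv.
  move/near_in_itvoo => -[e1 e10 he1].
  exists (Num.min e e1) => /=; first by rewrite lt_min e0.
  move=> h; rewrite /ball_/= sub0r normrN lt_min => /andP[hee hee1] h0.
  have := he (h + x); rewrite /ball_/= opprD addrCA subrr addr0 normrN => /(_ hee).
  have -> : (h + x != x) by rewrite -subr_eq0 addrK.
  move=> /(_ isT).
  have := he1 (h + x); rewrite /ball_/= opprD addrCA subrr addr0 normrN => /(_ hee1).
  rewrite in_itv/= => /andP[/ltW ahx /ltW hxb].
  rewrite in_itv/= ahx hxb => /(_ isT).
  by rewrite addrK /GRing.scale/= mulr1 [_^-1 * _]mulrC.
apply: DeriveDef; first by apply/cvg_ex; exists (f' x).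
exact/cvg_lim.
Qed.

Lemma continuous_itv_bounded (a b : R) (f : R -> R) : a <= b ->
  {within `[a, b], continuous f} ->
  exists2 K, 0 <= K & forall x, a <= x <= b -> `|f x| <= K.
Proof.
move=> ab cf.
have cnf : {within `[a, b], continuous (fun x => `|f x|)}.
  by move=> x; apply: continuous_comp; [exact: cf|exact: norm_continuous].
have [c _ hc] := EVT_max ab cnf.
by exists `|f c| => // x xab; apply: hc; rewrite in_itv.
Qed.

Lemma C1_itv_bounded (a b : R) (f : R -> R) : a <= b -> C1_itv a b f ->
  exists K f', [/\ 0 <= K, primitive_on a b f f',
    forall x, a <= x <= b -> `|f x| <= K &
    forall x, a < x < b -> `|f' x| <= K].
Proof.
move=> ab /C1_itv_primitive_on[f' cf' pf].
have [K1 K10 fK1] := continuous_itv_bounded ab (proj1 pf).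
have [K2 K20 fK2] := continuous_itv_bounded ab cf'.
exists (K1 + K2), f'; split => //; first exact: addr_ge0.
  by move=> x /fK1 /le_trans; apply; rewrite lerDl.
by move=> x /andP[/ltW ax /ltW xb]; rewrite (le_trans (fK2 x _)) ?ax// lerDr.
Qed.

Lemma singular_amplitude_lipschitz (mu K p1 p2 : R) F g g' :
  singular_amplitude mu K p1 p2 F g g' ->
  forall p, p1 <= p <= p2 -> `|g p - g p1| <= K * (p - p1).
Proof.
move=> [_ _ pg _ g'K] p /andP[p1p pp2].
have pV := primitive_onZ K (@primitive_on_derive _ p1 p id (fun=> 1)
  (fun x _ => @is_derive_id _ _ x 1)).
rewrite mulrBr; apply: (primitive_on_norm_le p1p pV (primitive_onS (lexx _) pp2 pg)).
move=> x /andP[p1x xp]; rewrite mulr1 g'K// p1x/=; exact: lt_le_trans pp2.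
Qed.

Lemma singular_amplitude_lin (mu K L p1 p2 r s : R) F f f' G g g' :
  singular_amplitude mu K p1 p2 F f f' -> singular_amplitude mu L p1 p2 G g g' ->
  singular_amplitude mu (`|r| * K + `|s| * L) p1 p2 (fun p => r * F p + s * G p)
    (fun p => r * f p + s * g p) (fun p => r * f' p + s * g' p).
Proof.
move=> [iF FE pf fK f'K] [iG GE pg gL g'L].
have comb (x y : R) : `|x| <= K -> `|y| <= L -> `|r * x + s * y| <= `|r| * K + `|s| * L.
  move=> xK yL; apply: (le_trans (ler_normD _ _)); rewrite !normrM.
  by apply: lerD; apply: ler_wpM2l.
split.
- have -> : EFin \o (fun p => r * F p + s * G p) =
    ((fun p => r%:E * (EFin \o F) p) \+ (fun p => s%:E * (EFin \o G) p))%E by [].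
  by apply: integrableD => //; exact: integrableZl.
- by move=> p pp; rewrite FE// GE//; ring.
- by apply: primitive_onD; exact: primitive_onZ.
- by move=> p pp; apply: comb; [exact: fK|exact: gL].
- by move=> p pp; apply: comb; [exact: f'K|exact: g'L].
Qed.

End C1_amplitudes.

(** * The solution as a quadratic phase integral *)

Section quadratic_phase.
Context {R : realType}.
Local Notation mu := (@lebesgue_measure R).
Implicit Types (F G : R -> R).

Lemma Rintegral_lin (D : set R) (r s : R) F G : measurable D ->
  mu.-integrable D (EFin \o F) -> mu.-integrable D (EFin \o G) ->
  \int[mu]_(p in D) (r * F p + s * G p) =
  r * \int[mu]_(p in D) F p + s * \int[mu]_(p in D) G p.
Proof.
move=> mD iF iG.
have iZ (c : R) H : mu.-integrable D (EFin \o H) ->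
    mu.-integrable D (EFin \o (fun p => c * H p)).
  move=> iH; have -> : EFin \o (fun p => c * H p) = (fun p => c%:E * (EFin \o H) p)%E by [].
  exact: integrableZl.
by rewrite RintegralD//; [rewrite !RintegralZl|exact: iZ|exact: iZ].
Qed.

Lemma integrable_mul_cos (a b : R) F (th : R -> R) : continuous th ->
  mu.-integrable `[a, b] (EFin \o F) ->
  mu.-integrable `[a, b] (EFin \o (fun p => F p * cos (th p))).
Proof.
move=> cth iF; apply: (integrableMl _ iF) => //.
- apply: measurable_funTS; apply: continuous_measurable_fun => p.
  apply: continuous_comp; [exact: cth|exact: continuous_cos].
- exists 1; split => // M M1 x _ /=; exact: le_trans (cos_max _) (ltW M1).
Qed.

Definition phase_integral F (p1 p2 t psi x : R) : R :=
  \int[mu]_(p in `[p1, p2]) (F p * cos (t * p ^+ 2 - x * p + psi)).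

Lemma continuous_phase (t psi x : R) : continuous (fun p : R => t * p ^+ 2 - x * p + psi).
Proof.
move=> p; apply: differentiable_continuous; apply/derivable1_diffP.
exact: ex_derive.
Qed.

Lemma phase_integral_lin (p1 p2 t psi x r s : R) F G :
  mu.-integrable `[p1, p2] (EFin \o F) -> mu.-integrable `[p1, p2] (EFin \o G) ->
  phase_integral (fun p => r * F p + s * G p) p1 p2 t psi x =
  r * phase_integral F p1 p2 t psi x + s * phase_integral G p1 p2 t psi x.
Proof.
move=> iF iG; rewrite /phase_integral -Rintegral_lin//.
- by apply: eq_Rintegral => p _; ring.
- by apply: integrable_mul_cos => //; exact: continuous_phase.
- by apply: integrable_mul_cos => //; exact: continuous_phase.
Qed.

(** Shifting the phase by - pi / 2 turns cosines into sines, so a single family of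
    cosine integrals carries both the real and the imaginary parts. *)
Lemma phase_integralD (p1 p2 t psi phi x : R) F :
  mu.-integrable `[p1, p2] (EFin \o F) ->
  phase_integral F p1 p2 t (psi + phi) x =
  cos phi * phase_integral F p1 p2 t psi x
  - sin phi * phase_integral F p1 p2 t (psi - pi / 2) x.
Proof.
move=> iF; rewrite /phase_integral -mulNr -Rintegral_lin//.
- apply: eq_Rintegral => p _; rewrite !addrA cosBpihalf [in LHS]cosD; ring.
- by apply: integrable_mul_cos => //; exact: continuous_phase.
- by apply: integrable_mul_cos => //; exact: continuous_phase.
Qed.

(** Completing the square, with t = d^(-2). *)
Lemma phase_integralE (p1 p2 t d psi x : R) F : d != 0 -> t * d ^+ 2 = 1 ->
  phase_integral F p1 p2 t psi x =
  chirp_integral F (x * d ^+ 2 / 2) d (psi - x ^+ 2 * d ^+ 2 / 4) p1 p2.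
Proof.
move=> d0 td; apply: eq_Rintegral => p _; congr (_ * cos _).
have -> : t = d ^- 2 by rewrite -[RHS]mul1r -td mulfK// expf_neq0.
by field.
Qed.

Lemma continuous_phase_integral (p1 p2 t psi : R) F :
  mu.-integrable `[p1, p2] (EFin \o F) ->
  continuous (phase_integral F p1 p2 t psi).
Proof.
move=> iF x.
have ix y : mu.-integrable `[p1, p2]
    (EFin \o (fun p => F p * cos (t * p ^+ 2 - y * p + psi))).
  by apply: integrable_mul_cos => //; exact: continuous_phase.
have cx p : continuous (fun y : R => F p * cos (t * p ^+ 2 - y * p + psi)).
  move=> y; apply: differentiable_continuous; apply/derivable1_diffP.
  exact: ex_derive.
apply: (@continuity_under_integral _ _ _ mu
  (fun y p => F p * cos (t * p ^+ 2 - y * p + psi)) `[p1, p2] _ (x - 1) (x + 1)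
  _ _ (fun p => `|F p|)) => //.
- by apply: aeW => p _ y _; exact: cx.
- exact: integrable_norm.
- move=> y _; apply: aeW => p _.
  by rewrite normrM -[leRHS]mulr1 ler_wpM2l// cos_max.
- by rewrite inE/= in_itv/=; lra.
Qed.

(** A nonempty open set has positive Lebesgue measure. *)
Lemma ae_le_continuous (f : R -> R) (M : R) : continuous f ->
  (\forall x \ae mu, f x <= M) -> forall x, f x <= M.
Proof.
move=> cf [N [mN N0 fN]] x; rewrite leNgt; apply/negP => Mx.
have : \forall y \near x, M < f y.
  exact: (cvgr_gt (f x) (cf x)).
move=> [e /= e0 he].
have sub : `]x - e, x + e[ `<=` N.
  move=> y; rewrite /= in_itv/= => yx; apply: fN => /=; apply/negP.
  rewrite -ltNge; apply: he => /=.
  by rewrite ltr_distlC.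
have : (mu `](x - e)%R, (x + e)%R[ <= mu N)%E by apply: le_measure; rewrite ?inE.
rewrite N0 lebesgue_measure_itv/= lte_fin ifT; last by lra.
by rewrite -EFinD lee_fin; lra.
Qed.

End quadratic_phase.

Section schroedinger.
Context {R : realType}.
Local Notation mu := (@lebesgue_measure R).

Lemma uS_phaseE (p1 p2 t x : R) (Fu0 : R -> R[i]) :
  csupp Fu0 `<=` `[p1, p2] ->
  mu.-integrable `[p1, p2] (EFin \o (fun p => complex.Re (Fu0 p))) ->
  mu.-integrable `[p1, p2] (EFin \o (fun p => complex.Im (Fu0 p))) ->
  let W F psi := phase_integral F p1 p2 t psi x in
  let Fr p := complex.Re (Fu0 p) in let Fi p := complex.Im (Fu0 p) in
  uS Fu0 t x = ((2 * pi)^-1 * (W Fr 0 + W Fi (- (pi / 2)))) +i*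
               ((2 * pi)^-1 * (W Fi 0 - W Fr (- (pi / 2)))).
Proof.
move=> sF iR iI; cbv zeta.
have supp0 p : ~ `[p1, p2]%classic p -> Fu0 p = 0.
  move=> np; apply/eqP; apply: contrapT => Fp; apply: np; apply: sF.
  by apply: subset_closure => /=; apply/negP.
have restr (f : R[i] -> R) (g : R -> R) : f 0 = 0 ->
    (forall p, f (Fu0 p * cis (- (t * fS p) + x * p)) = g p) ->
    \int[mu]_(p in setT) f (Fu0 p * cis (- (t * fS p) + x * p)) =
    \int[mu]_(p in `[p1, p2]) g p.
  move=> f0 fg; rewrite [RHS]Rintegral_mkcond; apply: eq_Rintegral => p _.
  rewrite patchE; case: ifPn => [_|]; first exact: fg.
  by rewrite notin_setE => /supp0 ->; rewrite mul0r.
have cosE p : cos (- (t * fS p) + x * p) = cos (t * p ^+ 2 - x * p + 0).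
  by rewrite -cosN /fS; congr cos; ring.
have sinE p : sin (- (t * fS p) + x * p) = - cos (t * p ^+ 2 - x * p - pi / 2).
  by rewrite cosBpihalf -sinN /fS; congr sin; ring.
rewrite /uS /solution /cintegral.
rewrite (restr (@complex.Re R) (fun p =>
    1 * (complex.Re (Fu0 p) * cos (t * p ^+ 2 - x * p + 0)) +
    1 * (complex.Im (Fu0 p) * cos (t * p ^+ 2 - x * p - pi / 2))))//; last first.
  move=> p; rewrite -cosE -[X in _ = _ + 1 * (_ * X)]opprK -sinE /cis.
  by case: (Fu0 p) => a b /=; ring.
rewrite (restr (@complex.Im R) (fun p =>
    1 * (complex.Im (Fu0 p) * cos (t * p ^+ 2 - x * p + 0)) +
    (-1) * (complex.Re (Fu0 p) * cos (t * p ^+ 2 - x * p - pi / 2))))//; last first.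
  move=> p; rewrite -cosE -[X in _ = _ + -1 * (_ * X)]opprK -sinE /cis.
  by case: (Fu0 p) => a b /=; ring.
rewrite !Rintegral_lin//; try by apply: integrable_mul_cos => //; exact: continuous_phase.
rewrite !mul1r mulN1r -!/(phase_integral _ _ _ _ _ _).
rewrite /GRing.mul/=.
by apply/eqP; rewrite eq_complex/= !mul0r subr0 addr0 !eqxx.
Qed.

Lemma cmod_le (z : R[i]) : cmod z <= `|complex.Re z| + `|complex.Im z|.
Proof.
case: z => a b; rewrite /cmod/= -[leRHS](@ger0_norm _ (`|a| + `|b|))//.
rewrite -[leRHS]sqrtr_sqr ler_wsqrtr// sqrrD !real_normK ?num_real//.
by rewrite lerD2r lerDl mulrn_wge0// mulr_ge0.
Qed.

Lemma norm_Re_le (z : R[i]) : `|complex.Re z| <= cmod z.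
Proof.
case: z => a b; rewrite /cmod/= -sqrtr_sqr ler_wsqrtr// lerDl sqr_ge0//.
Qed.

Lemma norm_Im_le (z : R[i]) : `|complex.Im z| <= cmod z.
Proof.
case: z => a b; rewrite /cmod/= -sqrtr_sqr ler_wsqrtr// lerDr sqr_ge0//.
Qed.

Lemma Linfty_norm_leP (f : R -> R[i]) (M : R) :
  (Linfty_norm f <= M%:E)%E <-> \forall x \ae mu, cmod (f x) <= M.
Proof.
have mT : (0 < mu setT)%E.
  by rewrite -set_itvNyy lebesgue_measure_itv/= addye// ltry.
rewrite /Linfty_norm unlock mT.
have E x : (`|(cmod (f x))%:E| <= M%:E)%E = (cmod (f x) <= M).
  by rewrite /= lee_fin ger0_norm// /cmod; case: (f x) => a b; exact: sqrtr_ge0.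
split => [/ess_supP|] [N [mN N0 sN]]; [|apply/ess_supP];
  by exists N; split => // x nx; apply: sN; move: nx; rewrite /= E.
Qed.

End schroedinger.

(** * The decay rate *)

Section decay.
Context {R : realType}.
Local Notation leb := (@lebesgue_measure R).

Lemma locally_integrable_itv (a b : R) (f : R -> R) :
  locally_integrable setT f -> leb.-integrable `[a, b] (EFin \o f).
Proof.
move=> [mf _ fK]; apply/integrableP; split.
  by apply/measurable_EFinP; exact: measurable_funTS.
by apply: fK => //; exact: segment_compact.
Qed.

Lemma condition_C1_amplitude (mu p1 p2 : R) (Fu0 : R -> R[i]) (proj : R[i] -> R) :
  p1 < p2 -> locally_integrable setT (fun p => proj (Fu0 p)) ->
  (forall (x : R) z, proj (x%:C * z) = x * proj z) ->
  forall util, C1_itv p1 p2 (fun p => proj (util p)) ->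
  (forall p, p1 < p <= p2 -> Fu0 p = ((p - p1) `^ (mu - 1))%:C * util p) ->
  exists K g', 0 <= K /\
    singular_amplitude mu K p1 p2 (fun p => proj (Fu0 p)) (fun p => proj (util p)) g'.
Proof.
move=> p12 lF projZ util uC1 FE.
have [K [g' [K0 pg gK g'K]]] := C1_itv_bounded (ltW p12) uC1.
exists K, g'; split => //; split => //; first exact: locally_integrable_itv.
by move=> p /andP[p1p /ltW pp2]; rewrite FE ?p1p.
Qed.

Lemma uS_upper_bound (mu p1 p2 : R) (Fu0 : R -> R[i]) K gr gr' L gi gi' :
  0 < mu -> mu <= 1 -> p1 < p2 -> csupp Fu0 `<=` `[p1, p2] -> 0 <= K -> 0 <= L ->
  singular_amplitude mu K p1 p2 (fun p => complex.Re (Fu0 p)) gr gr' ->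
  singular_amplitude mu L p1 p2 (fun p => complex.Im (Fu0 p)) gi gi' ->
  exists2 c : R, 0 < c & forall t x, 1 <= t ->
    cmod (uS Fu0 t x) <= c * t `^ (- (mu / 2)).
Proof.
move=> mu0 mu1 p12 sF K0 L0 sr si.
have [C C0 hC] := singular_chirp_bound mu0 mu1 p12 K0 sr.
have [D D0 hD] := singular_chirp_bound mu0 mu1 p12 L0 si.
have pi0 : 0 < (2 * pi : R)^-1 by rewrite invr_gt0 mulr_gt0// pi_gt0.
exists ((2 * pi)^-1 * (2 * (C + D)) + 1).
  by rewrite ltr_wpDl// mulr_ge0 ?(ltW pi0)// mulr_ge0// addr_ge0.
move=> t x t1; have t0 : 0 < t by exact: lt_le_trans t1.
pose d := t `^ (- 2^-1).
have d0 : 0 < d by exact: powR_gt0.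
have d1 : d <= 1 by rewrite -(powRr0 t) ler_powR// oppr_le0 invr_ge0.
have td : t * d ^+ 2 = 1.
  rewrite -powR_mulrn ?(ltW d0)// /d -powRrM mulNr mulVf// powR_inv1 ?(ltW t0)//.
  by rewrite divff// gt_eqF.
have -> : t `^ (- (mu / 2)) = d `^ mu.
  by rewrite /d -powRrM; congr (_ `^ _); rewrite mulNr mulrC.
have [ir _ _ _ _] := sr; have [ii _ _ _ _] := si.
rewrite (uS_phaseE t x sF ir ii); set m := d `^ mu.
have d0' : d != 0 by rewrite gt_eqF.
have m0 : 0 <= m by exact: powR_ge0.
have hr psi : `|phase_integral (fun p => complex.Re (Fu0 p)) p1 p2 t psi x| <= C * m.
  by rewrite (phase_integralE _ _ _ _ _ d0' td); exact: hC.
have hi psi : `|phase_integral (fun p => complex.Im (Fu0 p)) p1 p2 t psi x| <= D * m.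
  by rewrite (phase_integralE _ _ _ _ _ d0' td); exact: hD.
apply: (le_trans (cmod_le _)) => /=; rewrite !normrM (gtr0_norm pi0).
have tri1 := ler_normD (phase_integral (fun p => complex.Re (Fu0 p)) p1 p2 t 0 x)
  (phase_integral (fun p => complex.Im (Fu0 p)) p1 p2 t (- (pi / 2)) x).
have tri2 := ler_normB (phase_integral (fun p => complex.Im (Fu0 p)) p1 p2 t 0 x)
  (phase_integral (fun p => complex.Re (Fu0 p)) p1 p2 t (- (pi / 2)) x).
have := hr 0; have := hr (- (pi / 2)); have := hi 0; have := hi (- (pi / 2)).
move=> h1 h2 h3 h4.
rewrite -mulrDr [leRHS]mulrDl mul1r; apply: (@le_trans _ _ ((2 * pi)^-1 * (2 * (C + D)) * m)).
  by rewrite -[leRHS]mulrA; apply: ler_wpM2l; [exact: ltW|lra].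
by rewrite lerDl.
Qed.

(** With (r, m) = util(p1) and F = Fu0, conj (util(p1)) F has real part
    r Fr + m Fi, positive at p1 up to the singular factor, and imaginary part
    - m Fr + r Fi, vanishing there. The real combination Z of the real and
    imaginary parts of the solution undoes the phase exp(i p1^2 t) at
    x = 2 p1 t, and is the sum of the two chirp integrals to which
    singular_chirp_ge applies. *)
Lemma uS_lower_bound (mu p1 p2 : R) (Fu0 : R -> R[i]) K gr gr' L gi gi' :
  0 < mu -> mu <= 1 -> p1 < p2 -> csupp Fu0 `<=` `[p1, p2] -> 0 <= K -> 0 <= L ->
  singular_amplitude mu K p1 p2 (fun p => complex.Re (Fu0 p)) gr gr' ->
  singular_amplitude mu L p1 p2 (fun p => complex.Im (Fu0 p)) gi gi' ->
  0 < gr p1 ^+ 2 + gi p1 ^+ 2 ->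
  exists c C : R, [/\ 0 < c, 0 <= C & forall d M : R, 0 < d -> d <= 1 -> p1 + d / 2 < p2 ->
    (\forall x \ae leb, cmod (uS Fu0 (d ^- 2) x) <= M) ->
    c * d `^ mu - C * d `^ (mu + 2^-1) <= M].
Proof.
move=> mu0 mu1 p12 sF K0 L0 sr si n0.
set r := gr p1 in n0 *; set m := gi p1 in n0 *.
set n := r ^+ 2 + m ^+ 2 in n0.
pose Fr p := complex.Re (Fu0 p); pose Fi p := complex.Im (Fu0 p).
have s1 := singular_amplitude_lin r m sr si.
have s2 := singular_amplitude_lin (- m) r sr si.
have N1 : 0 <= `|r| * K + `|m| * L by rewrite addr_ge0// mulr_ge0.
have N2 : 0 <= `|- m| * K + `|r| * L by rewrite addr_ge0// mulr_ge0.
have k0 : 0 <= 7 / 8 * n by rewrite mulr_ge0// ltW.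
have lip1 := singular_amplitude_lipschitz s1.
have lip2 := singular_amplitude_lipschitz s2.
rewrite -/r -/m in lip1 lip2.
have e1 : r * r + m * m = n by rewrite /n !expr2.
have e2 : - m * r + r * m = 0 by ring.
rewrite e1 in lip1; rewrite e2 in lip2.
have [C1 C10 h1] : exists2 C : R, 0 <= C & forall d : R, 0 < d -> d <= 1 -> p1 + d / 2 < p2 ->
    7 / 8 * n / 168 * d `^ mu - C * d `^ (mu + 2^-1) <=
    chirp_integral (fun p => r * Fr p + m * Fi p) p1 d (- (pi / 2)) p1 p2.
  (* the sine, as a cosine of phase - pi / 2; s = 1 makes s + sin equal to
     1 - cos, and sin y >= 7/8 y on [0, 1/4] gives the rate k = 7/8 n *)
  apply: (singular_chirp_ge (s := 1) mu0 mu1 p12 N1 k0 s1 lip1).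
  - by rewrite normr1.
  - by move=> y; rewrite sinBpihalf mulr_ge0 ?(ltW n0)// subr_ge0 cos_le1.
  - move=> y yb; rewrite cosBpihalf mulrAC mulrC; apply: ler_wpM2l; first exact: ltW.
    exact: sin_ge_linear.
  - rewrite sinBpihalf.
    have : n * (1 - cos 4^-1) <= n * (4^-1 ^+ 2 / 2).
      by rewrite ler_pM2l// one_sub_cos_le.
    lra.
have [C2 C20 h2] : exists2 C : R, 0 <= C & forall d : R, 0 < d -> d <= 1 -> p1 + d / 2 < p2 ->
    0 / 168 * d `^ mu - C * d `^ (mu + 2^-1) <=
    chirp_integral (fun p => - m * Fr p + r * Fi p) p1 d pi p1 p2.
  (* minus the cosine, as a cosine of phase pi *)
  apply: (singular_chirp_ge (s := 0) (G0 := 0) mu0 mu1 p12 N2 (lexx 0) s2 lip2).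
  - by rewrite normr0.
  - by move=> y; rewrite mul0r.
  - by move=> y _; rewrite !mul0r.
  - by rewrite !mul0r.
pose A := `|r| + `|m|.
have A0 : 0 < A.
  rewrite lt_neqAle addr_ge0// andbT; apply/negP => /eqP/esym/eqP.
  rewrite paddr_eq0// !normr_eq0 => /andP[/eqP rz /eqP mz].
  by move: n0; rewrite /n rz mz expr0n/= addr0 ltxx.
have pi0 : 0 < (2 * pi : R) by rewrite mulr_gt0// pi_gt0.
pose B := 2 * A * (2 * pi).
have B0 : 0 < B by rewrite !mulr_gt0// pi_gt0.
exists (7 / 8 * n / 168 / B), ((C1 + C2) / B).
split; first by rewrite !divr_gt0// mulr_gt0.
  by rewrite divr_ge0 ?addr_ge0// ltW.
move=> d M d0 d1 dp2 aeM.
set t := d ^- 2 in aeM.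
have d0' : d != 0 by rewrite gt_eqF.
have td : t * d ^+ 2 = 1 by rewrite mulVf// expf_neq0.
have [ir _ _ _ _] := sr; have [ii _ _ _ _] := si.
rewrite -/Fr -/Fi in ir ii.
(* the ray along which the stationary point x / (2 t) is the singular point p1 *)
pose x0 := 2 * p1 * t.
pose phi := - (p1 ^+ 2 * t).
pose al := m * cos phi - r * sin phi.
pose be := - (r * cos phi + m * sin phi).
pose W F psi x := phase_integral F p1 p2 t psi x.
pose Z x := al * (W Fr 0 x + W Fi (- (pi / 2)) x) +
            be * (W Fi 0 x - W Fr (- (pi / 2)) x).
have abn (u v a b : R) : `|a| <= 1 -> `|b| <= 1 -> `|u * a + v * b| <= `|u| + `|v|.
  move=> a1 b1; apply: (le_trans (ler_normD _ _)); rewrite !normrM.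
  by apply: lerD; rewrite ler_piMr.
have alA : `|al| <= A.
  have -> : al = - r * sin phi + m * cos phi by rewrite /al; ring.
  by rewrite /A -(normrN r); apply: abn; [exact: sin_max|exact: cos_max].
have beA : `|be| <= A.
  by rewrite normrN; apply: abn; [exact: cos_max|exact: sin_max].
have ZM : forall x, Z x <= B * M.
  apply: ae_le_continuous.
    have cW F psi : leb.-integrable `[p1, p2] (EFin \o F) -> continuous (W F psi).
      exact: continuous_phase_integral.
    have cZ (u v : R) (f g h k : R -> R) :
        continuous f -> continuous g -> continuous h -> continuous k ->
        continuous (fun x => u * (f x + g x) + v * (h x - k x)).
      move=> cf cg ch ck x; apply: (@cvgD _ R^o); apply: cvgM; try exact: cvg_cst.
        by apply: (@cvgD _ R^o); [exact: cf|exact: cg].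
      by apply: (@cvgB _ R^o); [exact: ch|exact: ck].
    by apply: cZ; apply: cW.
  suff ZM x : cmod (uS Fu0 t x) <= M -> Z x <= B * M.
    move: aeM => [N [mN N0 sN]]; exists N; split => // x nx; apply: sN => uM.
    by apply: nx; exact: ZM.
  rewrite (uS_phaseE t x sF ir ii) => uM.
  have := norm_Re_le (uS Fu0 t x); have := norm_Im_le (uS Fu0 t x).
  rewrite (uS_phaseE t x sF ir ii)/= -/Fr -/Fi.
  rewrite -/(W Fr _ x) -/(W Fi _ x) !normrM gtr0_norm ?invr_gt0//.
  move=> /le_trans/(_ uM); rewrite ler_pdivrMl// => Ym.
  move=> /le_trans/(_ uM); rewrite ler_pdivrMl// => Xm.
  apply: (le_trans (ler_norm _)); apply: (le_trans (ler_normD _ _)).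
  rewrite !normrM.
  have -> : B * M = A * (2 * pi * M) + A * (2 * pi * M) by rewrite /B; ring.
  by apply: lerD; apply: ler_pM.
have {ZM} := ZM x0.
have ZE : Z x0 = chirp_integral (fun p => r * Fr p + m * Fi p) p1 d (- (pi / 2)) p1 p2
     + chirp_integral (fun p => - m * Fr p + r * Fi p) p1 d pi p1 p2.
  have ce F psi : chirp_integral F p1 d psi p1 p2 = W F (psi - phi) x0.
    rewrite /W (phase_integralE _ _ _ _ _ d0' td).
    have x0d : x0 * d ^+ 2 = 2 * p1 by rewrite /x0 -mulrA td mulr1.
    have -> : x0 * d ^+ 2 / 2 = p1 by rewrite x0d; field.
    have -> // : psi - phi - x0 ^+ 2 * d ^+ 2 / 4 = psi.
    have -> : x0 ^+ 2 * d ^+ 2 = 4 * p1 ^+ 2 * t.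
      by rewrite expr2 -mulrA x0d /x0; ring.
    by rewrite /phi; field.
  have rot F psi : leb.-integrable `[p1, p2] (EFin \o F) ->
     W F psi x0 = cos psi * W F 0 x0 - sin psi * W F (- (pi / 2)) x0.
    by move=> iF; rewrite -[in LHS](add0r psi) /W phase_integralD// sub0r.
  rewrite !ce /W !phase_integral_lin// -!/(W _ _ _).
  rewrite !(rot _ (_ - phi))//.
  rewrite -opprD cosN sinN [pi / 2 + phi]addrC cosDpihalf sinDpihalf.
  rewrite [pi - phi]addrC cosDpi sinDpi cosN sinN.
  by rewrite /Z /al /be; ring.
rewrite ZE; have {h1} := h1 d d0 d1 dp2; have {h2} := h2 d d0 d1 dp2.
rewrite !mul0r sub0r.
set a := chirp_integral _ _ _ _ _ _; set b := chirp_integral _ _ _ _ _ _.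
move=> h2 h1 h.
have -> : 7 / 8 * n / 168 / B * d `^ mu - (C1 + C2) / B * d `^ (mu + 2^-1) =
   (7 / 8 * n / 168 * d `^ mu - (C1 + C2) * d `^ (mu + 2^-1)) / B by field; rewrite gt_eqF.
by rewrite ler_pdivrMr// [M * B]mulrC; lra.
Qed.

Lemma powR_decay_contradiction (mu gam c C D L : R) : 0 < c -> mu < gam -> 0 < L ->
  ~ (forall d : R, 0 < d -> d <= 1 -> d < L ->
     c * d `^ mu - C * d `^ (mu + 2^-1) <= D * d `^ gam).
Proof.
move=> c0 mg L0 h.
have lim : (C * d `^ 2^-1 + D * d `^ (gam - mu)) @[d --> (0:R)^'+] --> (0 : R).
  have h0 (B s : R) : 0 < s -> (B * d `^ s) @[d --> (0:R)^'+] --> B * 0.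
    by move=> s0; apply: cvgM; [exact: cvg_cst|exact: powR_cvg0].
  have := cvgD (h0 C 2^-1 _) (h0 D (gam - mu) _).
  by rewrite !mulr0 addr0 invr_gt0 subr_gt0; apply.
(* after division by d^mu the inequality bounds c by a quantity tending to 0 *)
have := cvgr_lt _ lim _ c0.
move=> near_c.
have : \forall d \near (0:R)^'+, False.
  near=> d.
  have d0 : 0 < d by near: d; exact: nbhs_right_gt.
  have d1 : d <= 1 by near: d; exact: nbhs_right_le.
  have dL : d < L by near: d; exact: nbhs_right_lt.
  have hc : C * d `^ 2^-1 + D * d `^ (gam - mu) < c by near: d; exact: near_c.
  have := h d d0 d1 dL.
  have dn : d != 0 by rewrite gt_eqF.
  rewrite (_ : d `^ gam = d `^ mu * d `^ (gam - mu)); last first.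
    by rewrite -powRD ?dn ?implybT// addrC subrK.
  rewrite powRD ?dn ?implybT//.
  have m0 : 0 < d `^ mu by exact: powR_gt0.
  have := hc; rewrite -(ltr_pM2l m0); lra.
by move=> /filter_ex[].
Unshelve. all: by end_near. Qed.

End decay.

Theorem corollary4p5 (R : realType) (mu p1 p2 : R)
    (u0 : (R -> R[i]) -> R[i]) (Fu0 : R -> R[i])
    (mu_gt0 : 0 < mu) (mu_le1 : mu <= 1) (p1_lt_p2 : p1 < p2)
    (u0_tempered : tempered u0)
    (Fu0_fourier : distr_is_function (fourier_distr u0) Fu0)
    (u0_C1 : condition_C1 p1 p2 mu Fu0) :
  (exists c : R, 0 < c /\
    forall t : R, 1 <= t ->
      (Linfty_norm (uS Fu0 t) <= (c * t `^ (- (mu / 2)))%:E)%E) /\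
  ~ (exists gamma C : R, [/\ mu / 2 < gamma, 0 < C &
      forall t : R, 1 <= t ->
        (Linfty_norm (uS Fu0 t) <= (C * t `^ (- gamma))%:E)%E]).
Proof.
have [[lr li] _] := Fu0_fourier.
have [sF [util [[ur ui] u1 FE]]] := u0_C1.
have [|K [gr' [K0 sr]]] := condition_C1_amplitude p1_lt_p2 lr _ ur FE.
  by move=> x [a b] /=; ring.
have [|L [gi' [L0 si]]] := condition_C1_amplitude p1_lt_p2 li _ ui FE.
  by move=> x [a b] /=; ring.
have n0 : 0 < complex.Re (util p1) ^+ 2 + complex.Im (util p1) ^+ 2.
  move: u1; case: (util p1) => a b; rewrite eq_complex/= negb_and => ab.
  rewrite lt_neqAle addr_ge0 ?sqr_ge0// andbT eq_sym paddr_eq0 ?sqr_ge0//.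
  by rewrite !sqrf_eq0 negb_and.
split.
  have [c c0 hc] := uS_upper_bound mu_gt0 mu_le1 p1_lt_p2 sF K0 L0 sr si.
  exists c; split => // t t1; apply/Linfty_norm_leP.
  by apply: aeW => x; exact: hc.
move=> [gamma [C [mg C0 hC]]].
have [c [D [c0 D0 hl]]] := uS_lower_bound mu_gt0 mu_le1 p1_lt_p2 sF K0 L0 sr si n0.
have pL : 0 < 2 * (p2 - p1) by rewrite mulr_gt0// subr_gt0.
have mg2 : mu < 2 * gamma by lra.
apply: (powR_decay_contradiction (C := D) (D := C) c0 mg2 pL _) => d d0 d1 dL.
apply: hl => //; first by lra.
have t1 : 1 <= d ^- 2 by rewrite invf_ge1 ?exprn_gt0// expr_le1// ltW.
have /Linfty_norm_leP := hC _ t1.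
have -> // : (d ^- 2) `^ (- gamma) = d `^ (2 * gamma).
rewrite -(powR_invn 2 (ltW d0)) -powRrM; congr (_ `^ _); ring.
Qed.
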